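(* Let $(A,B)$ be a Weyl pair of dimension $d$ on a complex Banach space $X$, let $M_A:=\sup_{u\in\mathbb{R}^d}\|e^{iuA}\|$ and $M_B:=\sup_{v\in\mathbb{R}^d}\|e^{ivB}\|$, and let $1\le p<\infty$. (1) For all $a\in\mathscr{S}(\mathbb{R}^{2d})$ we have $\|a(A,B)\|\le M_A^2M_B^2\,\|C_{\widehat a}\|_{\mathscr{L}(L^p(\mathbb{R}^{2d};X))}$. (2) Let $\{a_j:\,j\in J\}$ be a family of functions in $\mathscr{S}(\mathbb{R}^{2d})$. If the family of twisted convolutions $\{C_{\widehat{a_j}}:\,j\in J\}$ is $R$-bounded in $\mathscr{L}(L^p(\mathbb{R}^{2d};X))$, then $\{a_j(A,B):\,j\in J\}$ is $R$-bounded in $\mathscr{L}(X)$, and in that case $$\mathscr{R}_p(\{a_j(A,B):\,j\in J\})\le M_A^2M_B^2\,\mathscr{R}_p(\{C_{\widehat{a_j}}:\,j\in J\}).$$ (3) Let $\{a_j:\,j\in J\}$ be a family of functions in $\mathscr{S}(\mathbb{R}^{2d})$ and let $(\varepsilon_j)_{j\in J}$ be a Rademacher sequence. If there is a constant $C$ such that $$\mathbb{E}\Big\|\sum_{j\in J}\varepsilon_jC_{\widehat{a_j}}g\Big\|_{L^p(\mathbb{R}^{2d};X)}\le C\|g\|_{L^p(\mathbb{R}^{2d};X)}\quad\text{for all } g\in L^p(\mathbb{R}^{2d};X),$$ then there is a constant $C'$ such that $$\mathbb{E}\Big\|\sum_{j\in J}\varepsilon_ja_j(A,B)f\Big\|\le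 C'\|f\|\quad\text{for all } f\in X.$$
   Context: Weyl pair: a pair $(A,B)$ of $d$-tuples $A=(A_1,\dots,A_d)$, $B=(B_1,\dots,B_d)$ of closed densely defined operators on a complex Banach space $X$ such that each $iA_j$ and $iB_j$ generates a uniformly bounded $C_0$-group, denoted $(e^{itA_j})_{t\in\mathbb{R}}$, $(e^{itB_j})_{t\in\mathbb{R}}$, and for all $s,t\in\mathbb{R}$, $1\le j,k\le d$: $e^{isA_j}e^{itA_k}=e^{itA_k}e^{isA_j}$, $e^{isB_j}e^{itB_k}=e^{itB_k}e^{isB_j}$, $e^{isA_j}e^{itB_k}=e^{-ist\delta_{jk}}e^{itB_k}e^{isA_j}$. For $u,v\in\mathbb{R}^d$: $uv=\sum_j u_jv_j$, $e^{iuA}=\prod_j e^{iu_jA_j}$, $e^{ivB}=\prod_j e^{iv_jB_j}$, $e^{i(uA+vB)}:=e^{\frac12 iuv}e^{iuA}e^{ivB}$. Weyl calculus: for $a\in\mathscr{S}(\mathbb{R}^{2d})$, $a(A,B)f=\frac{1}{(2\pi)^d}\int_{\mathbb{R}^{2d}}\widehat a(u,v)e^{i(uA+vB)}f\,du\,dv$ for $f\in X$, where $\widehat a(u,v)=\frac1{(2\pi)^d}\int_{\mathbb{R}^{2d}}a(x,\xi)e^{-i(xu+\xi v)}\,dx\,d\xi$. Twisted convolution: for $b\in\mathscr{S}(\mathbb{R}^{2d})$, $C_bg(x,\xi)=\frac1{(2\pi)^d}\int_{\mathbb{R}^{2d}}e^{\frac12 i(x\eta-y\xi)}b(y,\eta)g(x-y,\xi-\eta)\,dy\,d\eta$,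 which defines a bounded operator on $L^p(\mathbb{R}^{2d};X)$. A Rademacher sequence is a sequence of independent random variables uniformly distributed on the complex unit circle. A set $\mathscr{T}\subseteq\mathscr{L}(Y,Z)$ is $R$-bounded if for some (equivalently all) $p\in(0,\infty)$ there is a constant $C$ with $\mathbb{E}\|\sum_{n=1}^N\varepsilon_nT_ny_n\|^p\le C^p\,\mathbb{E}\|\sum_{n=1}^N\varepsilon_ny_n\|^p$ for all $N$, $T_1,\dots,T_N\in\mathscr{T}$, $y_1,\dots,y_N\in Y$; the least such $C$ is the $R_p$-bound $\mathscr{R}_p(\mathscr{T})$. If $J$ is infinite, the inequalities in (3) are understood as holding for the sums over all finite subsets of $J$, with constants independent of the finite subset. *)

(* Defs.v *)
From HB Require Import structures.
From mathcomp Require Import all_boot all_order all_algebra.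
From mathcomp Require Import complex.
From mathcomp Require Import all_classical all_reals all_analysis.

Set Implicit Arguments.
Unset Strict Implicit.
Unset Printing Implicit Defensive.
Import Order.TTheory GRing.Theory Num.Theory.
Import numFieldNormedType.Exports.

Local Open Scope classical_set_scope.
Local Open Scope ring_scope.

Definition measure_rV_display : measure_display.
Proof. exact: (measure_tuple_display default_measure_display). Qed.

Section measurable_rV.
Context (R : realType) (n : nat).

Let coors : 'I_n -> 'rV[R]_n -> measurableTypeR R := fun i x => x ord0 i.

Let rV_set0 : g_sigma_preimage coors set0.
Proof. exact: sigma_algebra0. Qed.

Let rV_setC A : g_sigma_preimage coors A -> g_sigma_preimage coors (~` A).
Proof. exact: sigma_algebraC. Qed.

Let rV_bigcup (F : _^nat) : (forall i, g_sigma_preimage coors (F i)) ->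
  g_sigma_preimage coors (\bigcup_i (F i)).
Proof. exact: sigma_algebra_bigcup. Qed.

HB.instance Definition _ := @isMeasurable.Build measure_rV_display
  'rV[R]_n (g_sigma_preimage coors) rV_set0 rV_setC rV_bigcup.

End measurable_rV.

(* The library's canonical sigma-finite instance on [m1 \x m2] is only found
   when [m1] and [m2] are finite measures. *)
Lemma sigma_finite_product_measure d1 d2 (T1 : measurableType d1)
    (T2 : measurableType d2) (R : realType)
    (m1 : {sigma_finite_measure set T1 -> \bar R})
    (m2 : {sigma_finite_measure set T2 -> \bar R}) :
  sigma_finite setT (m1 \x m2)%E.
Proof.
have /sigma_finiteP[F [TF ndF Foo]] := sigma_finiteT m1.
have /sigma_finiteP[G [TG ndG Goo]] := sigma_finiteT m2.
exists (fun n => F n `*` G n).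
 rewrite -setXTT TF TG predeqE => -[x y]; split.
    move=> [/= [n _ Fnx] [k _ Gky]]; exists (maxn n k) => //; split.
    - by move: x Fnx; exact/subsetPset/ndF/leq_maxl.
    - by move: y Gky; exact/subsetPset/ndG/leq_maxr.
  by move=> [n _ []/= ? ?]; split; exists n.
move=> k; have [? ?] := Foo k; have [? ?] := Goo k.
split; first exact: measurableX.
by rewrite product_measure1E// lte_mul_pinfty// ge0_fin_numE.
Qed.

Section lebesgue_rV.
Context (R : realType).

Definition rV_cons n (p : measurableTypeR R * 'rV[R]_n) : 'rV[R]_n.+1 :=
  \row_i if unlift ord0 i is Some j then p.2 ord0 j else p.1.

Definition rV_uncons n (x : 'rV[R]_n.+1) : measurableTypeR R * 'rV[R]_n :=
  (x ord0 ord0, \row_i x ord0 (lift ord0 i)).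

Lemma rV_consK n : cancel (@rV_cons n) (@rV_uncons n).
Proof.
case=> a v; rewrite /rV_cons /rV_uncons; congr pair.
  by rewrite mxE unlift_none.
by apply/rowP => i; rewrite !mxE liftK.
Qed.

Lemma rV_unconsK n : cancel (@rV_uncons n) (@rV_cons n).
Proof.
move=> x; apply/rowP => i; rewrite mxE.
by case: unliftP => [j|] -> //=; rewrite mxE.
Qed.

Lemma measurable_rV_coord n (i : 'I_n) :
  measurable_fun [set: 'rV[R]_n] (fun x => x ord0 i : measurableTypeR R).
Proof.
move=> _ Y mY; rewrite setTI; apply: sub_sigma_algebra => /=.
rewrite -bigcup_seq/=; exists i => /=; first by rewrite mem_index_enum.
by exists Y => //; rewrite setTI.
Qed.

Lemma measurable_fun_rV d (T : measurableType d) n (f : T -> 'rV[R]_n) :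
  (forall i, measurable_fun [set: T] (fun t => f t ord0 i : measurableTypeR R)) ->
  measurable_fun [set: T] f.
Proof.
move=> mf _ A mA; rewrite setTI.
suff: [set B | measurable (f @^-1` B)] A by [].
apply: mA; split => /=.
  split => /=.
  - by rewrite preimage_set0.
  - by move=> B mB /=; rewrite setTD -preimage_setC; exact: measurableC.
  - by move=> F mF /=; rewrite preimage_bigcup; exact: bigcup_measurable.
move=> B; rewrite -bigcup_seq/= => -[i _ [C mC <-]] /=.
by rewrite setTI -[X in measurable X]setTI; exact: (mf i).
Qed.

Lemma measurable_rV_cons n : measurable_fun setT (@rV_cons n).
Proof.
apply: measurable_fun_rV => i; under eq_fun do rewrite mxE.
case: unliftP => [j|] _; last exact: measurable_fst.
exact: measurableT_comp (measurable_rV_coord j) measurable_snd.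
Qed.

Lemma measurable_rV_uncons n : measurable_fun setT (@rV_uncons n).
Proof.
apply: measurable_fun_pair; first exact: measurable_rV_coord.
apply: measurable_fun_rV => i /=; under eq_fun do rewrite mxE.
exact: measurable_rV_coord.
Qed.

(* Product of n copies of the Lebesgue measure, transported from R * R^n to
   R^n.+1 at each step. *)
Fixpoint lebesgue_rV n : set 'rV[R]_n -> \bar R :=
  if n is n'.+1 then
    pushforward (lebesgue_measure \x @lebesgue_rV n')%E (@rV_cons n')
  else \d_(0 : 'rV[R]_0).

Lemma lebesgue_rV_ge0 n (A : set 'rV[R]_n) : (0 <= lebesgue_rV A)%E.
Proof.
elim: n A => [|n IH] A /=; first exact: measure_ge0.
by apply: integral_ge0 => x _; exact: IH.
Qed.

Let lebesgue_rV_step n (m : {sigma_finite_measure set 'rV[R]_n -> \bar R})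
    (mu := pushforward (lebesgue_measure \x m)%E (@rV_cons n)) :
  [/\ mu set0 = 0%E, semi_sigma_additive mu & sigma_finite setT mu].
Proof.
have [M ME] : exists M : {measure set (measurableTypeR R * 'rV[R]_n)%type -> \bar R},
    M = (lebesgue_measure \x m)%E :> (set _ -> \bar R).
  by exists [the {measure set _ -> \bar R} of (@lebesgue_measure R \x m)%E].
have := sigma_finite_product_measure (@lebesgue_measure R) m.
rewrite {}/mu -{}ME => sfM.
have mcons A : measurable A -> measurable (@rV_cons n @^-1` A).
  by move=> mA; rewrite -[X in measurable X]setTI; exact: measurable_rV_cons.
split.
- by rewrite /pushforward preimage_set0 measure0.
- move=> F mF tF mUF; rewrite /pushforward preimage_bigcup.
  apply: measure_semi_sigma_additive.
  + by move=> k; exact: mcons.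
  + apply/trivIsetP => /= i j _ _ ij; rewrite -preimage_setI.
    by move/trivIsetP : tF => /(_ _ _ _ _ ij) ->//; rewrite preimage_set0.
  + by rewrite -preimage_bigcup; exact: mcons.
- have [F FT Ffin] := sfM.
  exists (fun k => @rV_uncons n @^-1` F k).
    by rewrite -preimage_bigcup -FT preimage_setT.
  move=> k; have [mF Foo] := Ffin k; split.
    by rewrite -[X in measurable X]setTI; exact: measurable_rV_uncons.
  rewrite /pushforward -comp_preimage.
  by rewrite (_ : _ \o _ = id) ?preimage_id//; apply/funext; exact: rV_consK.
Qed.

Let lebesgue_rV_prop n :
  [/\ @lebesgue_rV n set0 = 0%E, semi_sigma_additive (@lebesgue_rV n) &
      sigma_finite setT (@lebesgue_rV n)].
Proof.
elim: n => [|n [IH0 IHs IHf]].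
  split; [exact: measure0|exact: measure_semi_sigma_additive|].
  exact: sigma_finiteT.
pose mm := isMeasure.Build _ _ R _ IH0 (@lebesgue_rV_ge0 n) IHs.
pose m0 : {measure set 'rV[R]_n -> \bar R} := HB.pack (@lebesgue_rV n) mm.
pose m : {sigma_finite_measure set 'rV[R]_n -> \bar R} :=
  HB.pack (Measure.sort m0) (Measure_isSigmaFinite.Build _ _ _ m0 IHf).
exact: (lebesgue_rV_step m).
Qed.

Let lebesgue_rV0 n : @lebesgue_rV n set0 = 0%E.
Proof. by have [] := lebesgue_rV_prop n. Qed.

Let lebesgue_rV_sigma_additive n : semi_sigma_additive (@lebesgue_rV n).
Proof. by have [] := lebesgue_rV_prop n. Qed.

Let lebesgue_rV_sigma_finite n : sigma_finite setT (@lebesgue_rV n).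
Proof. by have [] := lebesgue_rV_prop n. Qed.

HB.instance Definition _ n := isMeasure.Build _ _ _ (@lebesgue_rV n)
  (lebesgue_rV0 n) (@lebesgue_rV_ge0 n) (@lebesgue_rV_sigma_additive n).

HB.instance Definition _ n := Measure_isSigmaFinite.Build _ _ _
  (@lebesgue_rV n) (@lebesgue_rV_sigma_finite n).

End lebesgue_rV.

Section phase_space_measure.
Context (R : realType) (d : nat).

Definition lebesgue_phase : set ('rV[R]_d * 'rV[R]_d) -> \bar R :=
  (@lebesgue_rV R d \x @lebesgue_rV R d)%E.

HB.instance Definition _ := Measure.on lebesgue_phase.

HB.instance Definition _ := Measure_isSigmaFinite.Build _ _ _ lebesgue_phase
  (sigma_finite_product_measure (@lebesgue_rV R d) (@lebesgue_rV R d)).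

End phase_space_measure.

(* The norm of a complex normed module takes its values in [R[i]]; [rnorm] is
   the same norm as a real number. *)
Definition rnorm (R : realType) (X : normedModType R[i]) (x : X) : R :=
  complex.Re `|x|.

Section bochner.
Context (dT : measure_display) (T : measurableType dT) (R : realType).
Variables (mu : {measure set T -> \bar R}) (X : normedModType R[i]).
Implicit Types (f g s : T -> X).

Definition mu_simple s : Prop :=
  [/\ finite_set (range s), forall x, measurable (s @^-1` [set x])
    & forall x, x != 0 -> (mu (s @^-1` [set x]) < +oo)%E].

(* The term [x = 0], whose level set may have infinite measure, vanishes. *)
Definition simple_integral s : X :=
  \sum_(x \in range s) (fine (mu (s @^-1` [set x])))%:C%C *: x.

Definition strongly_measurable f : Prop :=
  exists s_ : (T -> X)^nat, (forall n, mu_simple (s_ n)) /\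
    {ae mu, forall t, s_ n t @[n --> \oo] --> f t}.

Definition is_bochner_integral f (I : X) : Prop :=
  exists s_ : (T -> X)^nat,
    [/\ forall n, mu_simple (s_ n),
        {ae mu, forall t, s_ n t @[n --> \oo] --> f t},
        (\int[mu]_t (rnorm (f t - s_ n t))%:E)%E @[n --> \oo] --> 0%E
      & simple_integral (s_ n) @[n --> \oo] --> I].

(* Equal to 0 when [f] is not Bochner integrable. *)
Definition bochner_integral f : X := xget 0 [set I | is_bochner_integral f I].

Definition Lp_norm (p : R) f : \bar R :=
  Lnorm mu p%:E (fun t => (rnorm (f t))%:E).

Definition Lp_fun (p : R) : set (T -> X) :=
  [set f | strongly_measurable f /\ (Lp_norm p f < +oo)%E].

End bochner.

Definition complex_integral (dT : measure_display) (T : measurableType dT)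
    (R : realType) (mu : {measure set T -> \bar R}) (f : T -> R[i]) : R[i] :=
  ((\int[mu]_t complex.Re (f t)) +i* (\int[mu]_t complex.Im (f t)))%C.

(* A linear space together with a subspace [sn_dom] on which [sn_norm] is a
   finite seminorm. It serves for X itself and for L^p(mu; X), the latter
   presented by functions instead of classes of functions modulo equality
   almost everywhere: the notions below depend only on the classes. *)
Record seminormed_space (R : realType) := SeminormedSpace {
  sn_sort :> lmodType R[i];
  sn_dom : set sn_sort;
  sn_norm : sn_sort -> \bar R }.

Definition normed_space (R : realType) (X : normedModType R[i]) :
    seminormed_space R :=
  @SeminormedSpace R X setT (fun x => (rnorm x)%:E).

Definition Lp_space (dT : measure_display) (T : measurableType dT)
    (R : realType) (mu : {measure set T -> \bar R}) (X : normedModType R[i])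
    (p : R) : seminormed_space R :=
  @SeminormedSpace R (T -> X) (@Lp_fun _ T R mu X p) (@Lp_norm _ T R mu X p).

Definition opnorm (R : realType) (Y Z : seminormed_space R) (S : Y -> Z) :
    \bar R :=
  ereal_sup [set sn_norm (S y) | y in
    [set y : Y | sn_dom y /\ (sn_norm y <= 1)%E]].

Section rademacher.
Context (R : realType).

(* R[i] carries no measurable structure; its Borel sets are those of R * R. *)
Definition complex_coords (z : R[i]) : measurableTypeR R * measurableTypeR R :=
  (complex.Re z, complex.Im z).

Lemma pi2_gt0 : 0 < pi *+ 2 :> R.
Proof. by rewrite pmulrn_lgt0 ?pi_gt0. Qed.

Definition uniform_circle : set (measurableTypeR R * measurableTypeR R) -> \bar R :=
  pushforward (uniform_prob pi2_gt0) (fun t => (cos t, sin t)).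

Definition rademacher (dO : measure_display) (Omega : measurableType dO)
    (P : probability Omega R) (I : eqType) (eps : I -> Omega -> R[i]) : Prop :=
  [/\ forall i, measurable_fun setT (complex_coords \o eps i),
      forall i B, measurable B ->
        P ((complex_coords \o eps i) @^-1` B) = uniform_circle B
    & forall (s : seq I) (B : I -> set (measurableTypeR R * measurableTypeR R)),
        uniq s -> (forall i, measurable (B i)) ->
        P (\bigcap_(i in [set` s]) ((complex_coords \o eps i) @^-1` B i)) =
        (\prod_(i <- s) P ((complex_coords \o eps i) @^-1` B i))%E].

End rademacher.

Section R_bounded.
Context (R : realType) (dO : measure_display) (Omega : measurableType dO).
Variables (P : probability Omega R) (eps : nat -> Omega -> R[i]).
Variables (Y Z : seminormed_space R).
Implicit Type TT : set (Y -> Z).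

(* These notions depend on the Rademacher sequence [eps] only through its law,
   which is the same for all of them. *)
Definition R_bound_by (p C : R) TT : Prop :=
  forall (N : nat) (S : 'I_N -> Y -> Z) (y : 'I_N -> Y),
    (forall n, TT (S n)) -> (forall n, sn_dom (y n)) ->
    (\int[P]_w (sn_norm (\sum_(n < N) eps n w *: S n (y n)) `^ p) <=
     (C `^ p)%:E * \int[P]_w (sn_norm (\sum_(n < N) eps n w *: y n) `^ p))%E.

Definition R_bounded TT : Prop :=
  exists2 p : R, 0 < p & exists2 C : R, 0 <= C & R_bound_by p C TT.

Definition R_bound (p : R) TT : \bar R :=
  ereal_inf [set C%:E | C in [set C : R | 0 <= C /\ R_bound_by p C TT]].

End R_bounded.

(* For an infinite index set, the finite subsets of J; for a finite one, only
   J itself. *)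
Definition summation_sets (J : Type) : set (set J) :=
  [set F | finite_set F /\ (finite_set [set: J] -> F = setT)].

Definition expi (R : realType) (t : R) : R[i] := (cos t +i* sin t)%C.

Definition dotp (R : realType) (d : nat) (u v : 'rV[R]_d) : R :=
  \sum_(j < d) u ord0 j * v ord0 j.

(* Only the values of [op_fun] on [op_dom] are meaningful. *)
Record unbounded_op (T : Type) := UnboundedOp {
  op_dom : set T;
  op_fun :> T -> T }.

Section weyl_pair.
Context (R : realType) (X : normedModType R[i]).
Implicit Type A : unbounded_op X.

Definition linear_op A : Prop :=
  op_dom A 0 /\ forall (c : R[i]) x y, op_dom A x -> op_dom A y ->
    op_dom A (c *: x + y) /\ A (c *: x + y) = c *: A x + A y.

Definition closed_op A : Prop :=
  closed [set z : X * X | op_dom A z.1 /\ z.2 = A z.1].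

Definition C0_group (T : R -> X -> X) : Prop :=
  [/\ forall t, linear (T t), forall t, continuous (T t),
      forall x, T 0 x = x, forall s t x, T (s + t) x = T s (T t x)
    & forall x, T t x @[t --> 0] --> x].

Definition uniformly_bounded (T : R -> X -> X) : Prop :=
  exists M : R, forall t x, rnorm (T t x) <= M * rnorm x.

Definition generates_i A (T : R -> X -> X) : Prop :=
  forall x y, (op_dom A x /\ y = 'i%C *: A x) <->
    ((h^-1)%:C%C *: (T h x - x) @[h --> 0^'] --> y).

Definition is_exp_group A (T : R -> X -> X) : Prop :=
  [/\ C0_group T, uniformly_bounded T & generates_i A T].

(* The group (e^{itA})_t; it is unique when it exists. *)
Definition exp_group A : R -> X -> X :=
  xget ((fun=> id) : R -> X -> X) [set T | is_exp_group A T].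

Definition group_generator A : Prop :=
  [/\ linear_op A, closed_op A, dense (op_dom A)
    & exists T, is_exp_group A T].

Definition weyl_pair (d : nat) (A B : 'I_d -> unbounded_op X) : Prop :=
  [/\ forall j, group_generator (A j), forall j, group_generator (B j),
      forall s t j k x, exp_group (A j) s (exp_group (A k) t x) =
        exp_group (A k) t (exp_group (A j) s x),
      forall s t j k x, exp_group (B j) s (exp_group (B k) t x) =
        exp_group (B k) t (exp_group (B j) s x)
    & forall s t j k x, exp_group (A j) s (exp_group (B k) t x) =
        expi (- (s * t * (j == k)%:R)) *:
          exp_group (B k) t (exp_group (A j) s x)].

Definition exp_tuple (d : nat) (A : 'I_d -> unbounded_op X) (u : 'rV[R]_d) :
    X -> X :=
  \big[(fun S T : X -> X => S \o T)/id]_(j < d) exp_group (A j) (u ord0 j).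

Definition exp_weyl (d : nat) (A B : 'I_d -> unbounded_op X)
    (w : 'rV[R]_d * 'rV[R]_d) (x : X) : X :=
  expi (dotp w.1 w.2 / 2) *: exp_tuple A w.1 (exp_tuple B w.2 x).

Definition group_bound (d : nat) (A : 'I_d -> unbounded_op X) : \bar R :=
  ereal_sup [set opnorm (Y := normed_space X) (Z := normed_space X)
    (exp_tuple A u) | u in [set: 'rV[R]_d]].

End weyl_pair.

Section schwartz.
Context (R : realType) (d : nat).
Local Notation E := ('rV[R]_d * 'rV[R]_d)%type.

Definition phase_coord (k : 'I_d + 'I_d) (z : E) : R :=
  match k with inl j => z.1 ord0 j | inr j => z.2 ord0 j end.

Definition phase_basis (k : 'I_d + 'I_d) : E :=
  match k with
  | inl j => (delta_mx ord0 j, 0)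
  | inr j => (0, delta_mx ord0 j)
  end.

Definition partials (s : seq ('I_d + 'I_d)) (f : E -> R) : E -> R :=
  foldr (fun k g => 'D_(phase_basis k) g) f s.

Definition smooth (f : E -> R) : Prop :=
  forall s, continuous (partials s f) /\
    forall k z, derivable (partials s f) z (phase_basis k).

(* A sequence of directions encodes a multi-index, both for the monomial and
   for the iterated partial derivative. *)
Definition real_schwartz (f : E -> R) : Prop :=
  smooth f /\ forall al be : seq ('I_d + 'I_d), exists M : R, forall z,
    `|(\prod_(k <- al) phase_coord k z) * partials be f z| <= M.

Definition schwartz (a : E -> R[i]) : Prop :=
  real_schwartz (fun z => complex.Re (a z)) /\
  real_schwartz (fun z => complex.Im (a z)).

Definition fourier (a : E -> R[i]) (w : E) : R[i] :=
  (((pi *+ 2) ^- d)%:C)%C * complex_integral (@lebesgue_phase R d)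
    (fun z => a z * expi (- (dotp z.1 w.1 + dotp z.2 w.2))).

Context (X : normedModType R[i]).

Definition weyl_calculus (A B : 'I_d -> unbounded_op X) (a : E -> R[i])
    (x : X) : X :=
  (((pi *+ 2) ^- d)%:C)%C *: bochner_integral (@lebesgue_phase R d)
    (fun w => fourier a w *: exp_weyl A B w x).

Definition twisted_convolution (b : E -> R[i]) (g : E -> X) (z : E) : X :=
  (((pi *+ 2) ^- d)%:C)%C *: bochner_integral (@lebesgue_phase R d)
    (fun w => (expi ((dotp z.1 w.2 - dotp w.1 z.2) / 2) * b w) *: g (z - w)).

End schwartz.

(* Main.v *)
(* Up to a phase, [W(-z) W(w)] is [W(w - z)] for [W(u, v) = e^(i(uA + vB))], and this
   phase is the one of the twisted convolution. Hence [W(-z) a(A,B) f] is the value at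
   [z] of the twisted convolution [C] of the Fourier transform of [a] with the orbit
   [z |-> W(-z) f]. The orbit is not in L^p; it is cut off outside the box of radius
   [n + m], which on the box of radius [n] perturbs the value by at most [e_m |f|],
   where [e_m] tends to [0] because the Fourier transform of [a] is integrable. As
   [|W|] is bounded by [M_A M_B], this bounds [|a(A,B) f|] times the L^p norm of the
   indicator of the small box by [M_A M_B] times the L^p norm of [C] applied to the
   truncated orbit, which has L^p norm at most [M_A M_B |f|] times that of the
   indicator of the large box. Both estimates hold for random linear combinations,
   pointwise in the random parameter, so that any moment can be taken: neither the
   Kahane inequality nor the Minkowski inequality is needed. The ratio of the norms of
   the indicators tends to [1] when [n] is a growing multiple of [m], and Fatou's lemma
   disposes of [e_m]. *)
Require Import Defs.
From HB Require Import structures.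
From mathcomp Require Import all_boot all_order all_algebra.
From mathcomp Require Import complex.
From mathcomp Require Import all_classical all_reals all_analysis.
From mathcomp Require Import measurable_realfun ring lra.

Set Implicit Arguments.
Unset Strict Implicit.
Unset Printing Implicit Defensive.
Import Order.TTheory GRing.Theory Num.Theory.
Import numFieldNormedType.Exports.

Local Open Scope classical_set_scope.
Local Open Scope ring_scope.

(** Every dominated-convergence and integrability argument on phase space rests on one function,
    [phase_weight], with a factor 1/(1 + x^2) for each of the 2d real coordinates. It is integrable,
    it dominates Schwartz functions and their Fourier transforms, and a translation by a vector of
    the unit box changes it by at most a constant factor. The last property provides the majorant of
    the difference quotients in the integration by parts.

    The two radii are decoupled. With n = (k+1)m the ratio of the norms of the indicators depends on
    k alone and the error e_m on m alone. The limit in k is therefore taken at fixed m, before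
    Fatou's lemma is applied in m, and no rate of decay of e_m enters.

    Parts (2) and (3) are moments of one estimate: moment q with arbitrary vectors for (2), moment 1
    with a single repeated vector for (3). Part (1) uses the same lower bound with one term, but
    there the twisted convolution is controlled on the unit ball only, so the vector is rescaled
    instead. The space X = 0 is set apart: its group bounds are 0, and the argument divides by M_A
    M_B. *)

Local Notation normc := ComplexField.Normc.normc.

(** * Norms on complex normed modules *)

Section rnorm.
Context (R : realType).

Lemma normc_ge0 (c : R[i]) : 0 <= normc c.
Proof. by case: c => a b; rewrite /= sqrtr_ge0. Qed.

Lemma normcZ (a : R) (c : R[i]) : normc (a%:C%C * c) = `|a| * normc c.
Proof. by rewrite ComplexField.Normc.normcM /= expr0n addr0 sqrtr_sqr. Qed.

Lemma normc_real (a : R) : normc (a%:C%C) = `|a|.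
Proof. by rewrite /= expr0n addr0 sqrtr_sqr. Qed.

Lemma normc_expi (t : R) : normc (expi t) = 1.
Proof. by rewrite /= cos2Dsin2 sqrtr1. Qed.

Lemma normc_le (a b : R) : normc (a +i* b)%C <= `|a| + `|b|.
Proof.
rewrite -[leRHS]ger0_norm ?addr_ge0// -sqrtr_sqr ler_wsqrtr// sqrrD.
rewrite !real_normK ?num_real// -addrA lerD2l lerDr.
by rewrite mulrn_wge0// mulr_ge0.
Qed.

Context (X : normedModType R[i]).
Implicit Types (x y : X) (c : R[i]).

Lemma rnormE x : `|x| = (rnorm x)%:C%C.
Proof.
have := normr_ge0 x; rewrite /rnorm; case: `|x| => a b.
by rewrite lecE /= => /andP[/eqP -> _].
Qed.

Lemma rnorm_ge0 x : 0 <= rnorm x.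
Proof. by have := normr_ge0 x; rewrite rnormE lecE /= => /andP[]. Qed.

Lemma rnorm0 : rnorm (0 : X) = 0.
Proof. by rewrite /rnorm normr0. Qed.

Lemma rnormN x : rnorm (- x) = rnorm x.
Proof. by rewrite /rnorm normrN. Qed.

Lemma rnormB x y : rnorm (x - y) = rnorm (y - x).
Proof. by rewrite /rnorm distrC. Qed.

Lemma ler_rnormD x y : rnorm (x + y) <= rnorm x + rnorm y.
Proof. by have := ler_normD x y; rewrite !rnormE -rmorphD lecR. Qed.

Lemma ler_rnormB x y : rnorm (x - y) <= rnorm x + rnorm y.
Proof. by rewrite -[rnorm y]rnormN ler_rnormD. Qed.

Lemma ler_rnorm_sum (I : Type) (s : seq I) (P : pred I) (F : I -> X) :
  rnorm (\sum_(i <- s | P i) F i) <= \sum_(i <- s | P i) rnorm (F i).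
Proof.
elim/big_ind2 : _ => [|x a y b xa yb|//]; first by rewrite rnorm0.
by rewrite (le_trans (ler_rnormD _ _))// lerD.
Qed.

Lemma rnormZ c x : rnorm (c *: x) = normc c * rnorm x.
Proof.
have cE : `|c| = (normc c)%:C%C by case: c.
by rewrite {1}/rnorm normrZ rnormE cE -rmorphM.
Qed.

Lemma rnorm_eq0 x : (rnorm x == 0) = (x == 0).
Proof.
by rewrite -[x == 0]normr_eq0 rnormE eq_complex /= eqxx andbT.
Qed.

Lemma ler_dist_rnorm x y : `|rnorm x - rnorm y| <= rnorm (x - y).
Proof.
have h (u v : X) : rnorm u - rnorm v <= rnorm (u - v).
  by rewrite lerBlDr -{1}(subrK v u) ler_rnormD.
by rewrite ler_norml lerNl opprB h rnormB h.
Qed.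

Lemma cvg_rnormP (T : Type) (F : set_system T) {FF : Filter F} (f : T -> X) (l : X) :
  f @ F --> l <-> rnorm (f t - l) @[t --> F] --> (0 : R).
Proof.
split=> [/cvgrPdist_lt fl|/cvgrPdist_lt fl]; apply/cvgrPdist_lt => e e0.
  have /fl : 0 < e%:C%C :> R[i] by rewrite ltcR.
  apply: filterS => t; rewrite sub0r normrN ger0_norm ?rnorm_ge0//.
  by rewrite rnormE ltcR rnormB.
have eE : e = (complex.Re e)%:C%C.
  by move: e0; case: (e) => a b; rewrite ltcE /= => /andP[/eqP ->].
have /fl : 0 < complex.Re e by move: e0; rewrite eE ltcR.
apply: filterS => t; rewrite sub0r normrN ger0_norm ?rnorm_ge0//.
by rewrite eE rnormE ltcR rnormB.
Qed.

Lemma cvg_rnorm (T : Type) (F : set_system T) {FF : Filter F} (f : T -> X) (l : X) :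
  f @ F --> l -> rnorm (f t) @[t --> F] --> rnorm l.
Proof.
move=> /cvg_rnormP/cvgrPdist_lt fl; apply/cvgrPdist_lt => e /fl.
apply: filterS => t; rewrite sub0r normrN ger0_norm ?rnorm_ge0// => /le_lt_trans.
by apply; rewrite distrC ler_dist_rnorm.
Qed.

End rnorm.

(* The integral of a nonnegative function is a supremum over the simple
   functions below it, so that no measurability is needed here. *)
Lemma ge0_integral_mono d (T : measurableType d) (R : realType)
    (mu : {measure set T -> \bar R}) (f g : T -> \bar R) :
  (forall t, 0 <= f t)%E -> (forall t, f t <= g t)%E ->
  (\int[mu]_t f t <= \int[mu]_t g t)%E.
Proof.
move=> f0 fg; have g0 t : (0 <= g t)%E by exact: le_trans (fg t).
rewrite !ge0_integralTE//; apply: ge_ereal_sup => _ [h hf <-].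
by apply: ereal_sup_ubound; exists h => // x; exact: le_trans (fg x).
Qed.

(** * Simple functions and the Bochner integral *)

Lemma partition_fsbig (Y Z : choiceType) (V : nmodType) (phi : Y -> Z)
    (A : set Y) (F : Y -> V) : finite_set A ->
  \sum_(y \in A) F y =
  \sum_(z \in phi @` A) \sum_(y \in A `&` phi @^-1` [set z]) F y.
Proof.
move=> finA; under [RHS]eq_fsbigr do rewrite fsbig_mkcondr.
rewrite exchange_fsbig//; last exact: finite_image.
apply: eq_fsbigr => y /[!inE] Ay.
rewrite (fsbigD1 (phi y))//; last exact: finite_image.
rewrite mem_set// fsbig1 ?Monoid.mulm1// => z [_ zy].
by rewrite memNset//= => yz; exact: zy.
Qed.

Section simple_functions.
Context (dT : measure_display) (T : measurableType dT) (R : realType).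
Context (mu : {measure set T -> \bar R}).

Lemma simple_preimage (Y : choiceType) (p : T -> Y) (B : set Y) :
  p @^-1` B = \bigcup_(y in range p `&` B) p @^-1` [set y].
Proof.
apply/seteqP; split=> [t Bt|t [y [_ By] /= ty]]; last by rewrite /preimage/= ty.
by exists (p t) => //; split=> //; exists t.
Qed.

Lemma measurable_simple_preimage (Y : choiceType) (p : T -> Y) (B : set Y) :
  finite_set (range p) -> (forall y, measurable (p @^-1` [set y])) ->
  measurable (p @^-1` B).
Proof.
move=> finp mp; rewrite simple_preimage; apply: fin_bigcup_measurable => //.
exact: finite_setIl.
Qed.

Lemma measure_simple_preimage (Y : choiceType) (p : T -> Y) (B : set Y) :
  finite_set (range p) -> (forall y, measurable (p @^-1` [set y])) ->
  mu (p @^-1` B) = (\sum_(y \in range p `&` B) mu (p @^-1` [set y]))%E.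
Proof.
move=> finp mp; rewrite simple_preimage measure_fin_bigcup//.
  exact: finite_setIl.
apply/trivIsetP => y z _ _ yz; apply/seteqP; split=> // t [/= ty tz].
by move: yz; rewrite -ty tz eqxx.
Qed.

Context (X : normedModType R[i]).

(** A level set of [phi \o p] off zero is a finite union of fibres of [p] of finite measure. The
    auxiliary [p] is a pair of simple functions, a simple function under a linear map, or the index
    of a grid cell. *)
Lemma mu_simple_comp (Y : choiceType) (p : T -> Y) (phi : Y -> X) :
  finite_set (range p) -> (forall y, measurable (p @^-1` [set y])) ->
  (forall y, phi y != 0 -> (mu (p @^-1` [set y]) < +oo)%E) ->
  mu_simple mu (phi \o p).
Proof.
move=> finp mp oop.
split => [|x|x x0].
- rewrite -(image_comp p phi); exact: finite_image.
- by rewrite comp_preimage; exact: measurable_simple_preimage.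
- rewrite comp_preimage measure_simple_preimage// fsbig_finite/=; last exact: finite_setIl.
  rewrite big_seq; apply: lte_sum_pinfty => y.
  rewrite in_fset_set; last exact: finite_setIl.
  by rewrite inE => -[_ /= yx]; apply: oop; rewrite yx.
Qed.

(** The integral may be computed on the fibres of [p], which are finer than the level sets of
    [phi \o p]. Several functions of the same [p] then become sums over one index set. *)
Lemma simple_integral_comp (Y : choiceType) (p : T -> Y) (phi : Y -> X) :
  finite_set (range p) -> (forall y, measurable (p @^-1` [set y])) ->
  (forall y, phi y != 0 -> (mu (p @^-1` [set y]) < +oo)%E) ->
  simple_integral mu (phi \o p) =
  \sum_(y \in range p) (fine (mu (p @^-1` [set y])))%:C%C *: phi y.
Proof.
move=> finp mp oop; rewrite /simple_integral [RHS](partition_fsbig phi)//.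
rewrite (image_comp p phi); apply: eq_fsbigr => x _.
have [->|x0] := eqVneq x 0.
  by rewrite scaler0 fsbig1// => y [_ ->]; rewrite scaler0.
rewrite comp_preimage measure_simple_preimage//.
have finI : finite_set (range p `&` phi @^-1` [set x]) by exact: finite_setIl.
rewrite !fsbig_finite//= big_seq [in RHS]big_seq -sum_fine; last first.
  move=> y; rewrite in_fset_set// inE => -[_ /= yx].
  by rewrite ge0_fin_numE// oop// yx.
rewrite rmorph_sum/= scaler_suml; apply: eq_bigr => y.
by rewrite in_fset_set// inE => -[_ /= ->].
Qed.

Lemma simple_integral_linear (c : R[i]) (s1 s2 : T -> X) :
  mu_simple mu s1 -> mu_simple mu s2 ->
  mu_simple mu (fun t => c *: s1 t + s2 t) /\
  simple_integral mu (fun t => c *: s1 t + s2 t) =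
  c *: simple_integral mu s1 + simple_integral mu s2.
Proof.
move=> [fin1 m1 oo1] [fin2 m2 oo2].
(* The fibres of the pair are a common refinement of the level sets of [s1] and [s2]. The
   combination, [s1] and [s2] are all functions of [p], so [H] applies to each of the three. *)
pose p t := (s1 t, s2 t).
have pE y : p @^-1` [set y] = s1 @^-1` [set y.1] `&` s2 @^-1` [set y.2].
  by apply/seteqP; split=> [t /= <-//|t /= [y1 y2]]; rewrite /p y1 y2; case: (y).
have finp : finite_set (range p).
  apply: sub_finite_set (finite_setX fin1 fin2) => _ [t _ <-].
  by split; exists t.
have mp y : measurable (p @^-1` [set y]) by rewrite pE; exact: measurableI.
have oop y : y != 0 -> (mu (p @^-1` [set y]) < +oo)%E.
  case: y => y1 y2 y0; rewrite pE/=.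
  have [y10|y10] := eqVneq y1 0.
    have y20 : y2 != 0 by apply: contra y0 => /eqP ->; rewrite y10.
    by apply: le_lt_trans (oo2 _ y20); apply: le_measure; rewrite ?inE//; exact: measurableI.
  by apply: le_lt_trans (oo1 _ y10); apply: le_measure; rewrite ?inE//; exact: measurableI.
have H (phi : X * X -> X) : phi 0 = 0 -> mu_simple mu (phi \o p) /\
    simple_integral mu (phi \o p) =
    \sum_(y \in range p) (fine (mu (p @^-1` [set y])))%:C%C *: phi y.
  move=> phi0; have oo y : phi y != 0 -> (mu (p @^-1` [set y]) < +oo)%E.
    by move=> py; apply: oop; apply: contra py => /eqP ->; rewrite phi0.
  by split; [exact: mu_simple_comp|exact: simple_integral_comp].
have [sm ->] := H (fun y => c *: y.1 + y.2) ltac:(by rewrite /= scaler0 addr0).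
have [_ E1] := H fst erefl; have [_ E2] := H snd erefl.
split=> //; rewrite [X in _ = _ *: X + _]E1 [X in _ = _ + X]E2.
rewrite !fsbig_finite//= scaler_sumr -big_split/=; apply: eq_bigr => y _.
by rewrite scalerDr !scalerA mulrC.
Qed.

Lemma le_rnorm_simple_integral (s : T -> X) : mu_simple mu s ->
  ((rnorm (simple_integral mu s))%:E <= \int[mu]_t (rnorm (s t))%:E)%E.
Proof.
move=> [fins ms oos].
have E t : (rnorm (s t))%:E =
    (\sum_(x \in range s) ((rnorm x)%:E * (\1_(s @^-1` [set x]) t)%:E))%E.
  rewrite (fsbigD1 (s t))//=; last by exists t.
  rewrite indicE mem_set// mule1 fsbig1 ?Monoid.mulm1// => x [_ xs].
  by rewrite indicE memNset ?mule0//= => /esym.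
under eq_integral do rewrite E.
rewrite ge0_integral_fsum//; last first.
- by move=> x t _; rewrite -EFinM lee_fin mulr_ge0// rnorm_ge0.
- by move=> x; apply: measurable_funeM; apply/measurable_EFinP; exact: measurable_indic.
rewrite /simple_integral !fsbig_finite//=.
apply: (@le_trans _ _ (_%:E)); first by rewrite lee_fin; exact: ler_rnorm_sum.
rewrite -sumEFin; apply: lee_sum => x _.
rewrite ge0_integralZl_EFin ?rnorm_ge0//; last first.
  by apply/measurable_EFinP; exact: measurable_indic.
rewrite integral_indic// setIT rnormZ normc_real ger0_norm ?fine_ge0//.
(* The level set of 0 may have infinite measure, which [fine] sends to 0. Both sides vanish there
   anyway, because the norm of the value is 0. *)
have [->|x0] := eqVneq x 0; first by rewrite rnorm0 mulr0 mul0e.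
by rewrite mulrC EFinM fineK// ge0_fin_numE// oos.
Qed.

End simple_functions.

(** * Everywhere limits of simple functions and their approximation in L1 *)

Section simple_limits.
Context (dT : measure_display) (T : measurableType dT) (R : realType).
Context (mu : {measure set T -> \bar R}) (X : normedModType R[i]).
Implicit Types (f g s : T -> X).

(* Unlike [strongly_measurable], the convergence holds everywhere, so that
   [rnorm \o f] is measurable without completing the measure. *)
Definition simple_limit f := exists s_ : (T -> X)^nat,
  (forall n, mu_simple mu (s_ n)) /\ forall t, s_ n t @[n --> \oo] --> f t.

Lemma simple_limit_strongly_measurable f :
  simple_limit f -> strongly_measurable mu f.
Proof. by move=> [s_ [ms sf]]; exists s_; split=> //; exact: aeW. Qed.

Lemma simple_limit_simple s : mu_simple mu s -> simple_limit s.
Proof. by move=> ms; exists (fun=> s); split=> // t; exact: cvg_cst. Qed.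

Lemma simple_limit_linear (c : R[i]) f g : simple_limit f -> simple_limit g ->
  simple_limit (fun t => c *: f t + g t).
Proof.
move=> [sf [msf fP]] [sg [msg gP]].
exists (fun n t => c *: sf n t + sg n t); split=> [n|t].
  by have [] := simple_integral_linear c (msf n) (msg n).
by apply: cvgD => //; apply: cvgZr; exact: fP.
Qed.

Lemma measurable_rnorm_simple s : mu_simple mu s ->
  measurable_fun setT (fun t => rnorm (s t)).
Proof.
move=> [fins ms _] _ B _; rewrite setTI.
exact: (measurable_simple_preimage ((@rnorm R X) @^-1` B) fins ms).
Qed.

Lemma measurable_rnorm_simple_limit f : simple_limit f ->
  measurable_fun setT (fun t => rnorm (f t)).
Proof.
move=> [s_ [ms sf]]; apply: (@measurable_fun_cvg _ _ _ _ (fun n t => rnorm (s_ n t))).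
  by move=> n; exact: measurable_rnorm_simple.
by move=> t _; exact: cvg_rnorm.
Qed.

Definition L1_norm f := (\int[mu]_t (rnorm (f t))%:E)%E.

Lemma L1_norm_linear (c : R[i]) f g : simple_limit f -> simple_limit g ->
  (L1_norm (fun t => c *: f t + g t)%R <= (normc c)%:E * L1_norm f + L1_norm g)%E.
Proof.
move=> fP gP; have mf := measurable_rnorm_simple_limit fP.
have mg := measurable_rnorm_simple_limit gP.
rewrite /L1_norm -ge0_integralZl_EFin ?normc_ge0//; last 2 first.
- by move=> t _; rewrite lee_fin rnorm_ge0.
- exact/measurable_EFinP.
rewrite -ge0_integralD//; last 4 first.
- by move=> t _; rewrite -EFinM lee_fin mulr_ge0// ?normc_ge0 ?rnorm_ge0.
- by apply: measurable_funeM; exact/measurable_EFinP.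
- by move=> t _; rewrite lee_fin rnorm_ge0.
- exact/measurable_EFinP.
apply: ge0_integral_mono => t; first by rewrite lee_fin rnorm_ge0.
by rewrite -EFinM -EFinD lee_fin (le_trans (ler_rnormD _ _))// rnormZ.
Qed.

Lemma L1_normB f g : simple_limit f -> simple_limit g ->
  (L1_norm (fun t => f t - g t)%R <= L1_norm f + L1_norm g)%E.
Proof.
move=> fP gP; have := L1_norm_linear (-1) gP fP.
rewrite /= sqrrN expr1n oppr0 expr0n addr0 sqrtr1 mul1e addeC; apply: le_trans.
apply: ge0_integral_mono => t; first by rewrite lee_fin rnorm_ge0.
by rewrite scaleN1r addrC.
Qed.

Lemma simple_limitB f g : simple_limit f -> simple_limit g ->
  simple_limit (fun t => f t - g t).
Proof.
move=> fP gP; have [s_ [ms sP]] := simple_limit_linear (-1) gP fP.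
by exists s_; split=> // t; have := sP t; rewrite scaleN1r addrC.
Qed.

Lemma mu_simple_restrict s (A : set T) : measurable A -> mu_simple mu s ->
  mu_simple mu (fun t => if t \in A then s t else 0).
Proof.
move=> mA [fins ms oos]; set r := fun t => _.
have sub x : x != 0 -> r @^-1` [set x] = s @^-1` [set x] `&` A.
  move=> x0; apply/seteqP; split=> t; rewrite /r /=; case: ifPn.
  - by rewrite inE.
  - by move=> _ x0'; move: x0; rewrite -x0' eqxx.
  - by rewrite inE => tA [].
  - by rewrite notin_setE => tA [].
split=> [|x|x x0].
- apply: (@sub_finite_set _ _ (range s `|` [set 0])).
    by move=> _ [t _ <-]; rewrite /r; case: ifP => _; [left; exists t|right].
  by rewrite finite_setU; split.
- have [->|x0] := eqVneq x 0; last by rewrite sub//; exact: measurableI.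
  rewrite (_ : _ @^-1` _ = (s @^-1` [set 0] `&` A) `|` ~` A).
    by apply: measurableU; [exact: measurableI|exact: measurableC].
  apply/seteqP; split=> t; rewrite /r /=; case: ifPn.
  - by rewrite inE; left.
  - by rewrite notin_setE; right.
  - by rewrite inE => tA [[]|].
  - by [].
- rewrite sub//; apply: le_lt_trans (oos _ x0).
  by apply: le_measure; rewrite ?inE//; exact: measurableI.
Qed.

Lemma simple_limit_restrict f (A : set T) : measurable A -> simple_limit f ->
  simple_limit (fun t => if t \in A then f t else 0).
Proof.
move=> mA [s_ [ms sf]]; exists (fun n t => if t \in A then s_ n t else 0).
split=> [n|t]; first exact: mu_simple_restrict.
by case: ifP => // _; exact: cvg_cst.
Qed.

(* Cutting [s_ n] off where it exceeds [2 * rnorm (f t)] only brings it closer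
   to [f]. *)
Lemma simple_limit_L1 f : simple_limit f -> (L1_norm f < +oo)%E ->
  exists s_ : (T -> X)^nat, [/\ forall n, mu_simple mu (s_ n),
    forall t, s_ n t @[n --> \oo] --> f t &
    L1_norm (fun t => f t - s_ n t) @[n --> \oo] --> 0%E].
Proof.
move=> fP oof; have [s_ [ms sf]] := fP.
have mf := measurable_rnorm_simple_limit fP.
pose A n := [set t | rnorm (s_ n t) <= 2 * rnorm (f t)].
have mA n : measurable (A n).
  rewrite -[A n]setTI; apply: (measurable_fun_ler _ _ measurableT (Y := [set true])) => //.
    exact: measurable_rnorm_simple.
  exact: measurable_funM.
pose r n t := if t \in A n then s_ n t else 0.
have mr n : mu_simple mu (r n) by exact: mu_simple_restrict.
have rs n t : rnorm (f t - r n t) <= rnorm (f t - s_ n t).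
  rewrite /r; case: ifPn => //; rewrite notin_setE /A /= subr0 => /negP.
  rewrite -ltNge => sft; have := ler_dist_rnorm (s_ n t) (f t).
  rewrite rnormB => /(le_trans (ler_norm _)); lra.
(* Where [s_ n] is kept, it is at most twice the norm of [f], whence 3 = 1 + 2. This is the majorant
   for dominated convergence. *)
have rf n t : rnorm (f t - r n t) <= 3 * rnorm (f t).
  rewrite /r; case: ifPn => [|_].
    rewrite inE /A /= => sft; have := ler_rnormB (f t) (s_ n t); lra.
  by rewrite subr0; have := rnorm_ge0 (f t); lra.
have r0 t : rnorm (f t - r n t) @[n --> \oo] --> (0 : R).
  apply: (@squeeze_cvgr _ _ _ _ (cst 0) (fun n => rnorm (f t - s_ n t))).
  - by apply: nearW => n /=; rewrite rs rnorm_ge0.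
  - exact: cvg_cst.
  - have /cvg_rnormP := sf t.
    by under eq_cvg do rewrite rnormB.
exists r; split=> // [t|].
  apply/cvg_rnormP; have := r0 t.
  by under eq_cvg do rewrite rnormB.
rewrite -[X in _ --> X](integral0 mu setT).
apply: (@dominated_cvg _ _ _ mu setT measurableT
  (fun n t => (rnorm (f t - r n t))%:E) (cst 0%E)
  (fun t => (3 * rnorm (f t))%:E)) => //.
- move=> n; apply/measurable_EFinP; apply: measurable_rnorm_simple_limit.
  by apply: simple_limitB => //; exact: simple_limit_simple.
- by move=> t _; apply/fine_cvgP; split; [exact: nearW|exact: r0].
- apply/integrableP; split.
    by apply/measurable_EFinP; exact: measurable_funM.
  under eq_integral do rewrite gee0_abs ?lee_fin ?mulr_ge0 ?rnorm_ge0// EFinM.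
  rewrite ge0_integralZl_EFin//; last 2 first.
  - by move=> t _; rewrite lee_fin rnorm_ge0.
  - exact/measurable_EFinP.
  exact: lte_mul_pinfty.
- by move=> n t _; rewrite gee0_abs lee_fin// rnorm_ge0.
Qed.

End simple_limits.

(** * Norm bound, linearity, uniqueness and existence of the Bochner integral *)

Section bochner_integral.
Context (dT : measure_display) (T : measurableType dT) (R : realType).
Context (mu : {measure set T -> \bar R}).

Lemma rnorm_simple_integralB (X : normedModType R[i]) (s r : T -> X) :
  mu_simple mu s -> mu_simple mu r ->
  ((rnorm (simple_integral mu s - simple_integral mu r))%:E <=
   L1_norm mu (fun t => s t - r t)%R)%E.
Proof.
move=> ms mr; have [msr] := simple_integral_linear (-1) mr ms.
rewrite scaleN1r addrC => <-; apply: le_trans (le_rnorm_simple_integral msr) _.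
apply: ge0_integral_mono => t; first by rewrite lee_fin rnorm_ge0.
by rewrite scaleN1r addrC.
Qed.

Section properties.
Context (X : normedModType R[i]).
Implicit Types (f g s : T -> X) (I J : X).

Lemma simple_approximation f I : simple_limit mu f -> is_bochner_integral mu f I ->
  forall e : R, 0 < e -> exists s, [/\ mu_simple mu s,
    (L1_norm mu (fun t => f t - s t)%R <= e%:E)%E &
    rnorm (simple_integral mu s - I) <= e].
Proof.
move=> fP [s_ [ms _ fs sI]] e e0.
have /cvg_rnormP/cvgrPdist_le/(_ _ e0) near1 := sI.
have /fine_cvgP[fin1 /cvgrPdist_le/(_ _ e0) near2] := fs.
near \oo => n; exists (s_ n); split=> //.
- rewrite /L1_norm -[X in (X <= _)%E]fineK; last by near: n.
  rewrite lee_fin; have : `|0 - fine (\int[mu]_t (rnorm (f t - s_ n t))%:E)| <= e.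
    by near: n.
  by rewrite sub0r normrN; exact: le_trans (ler_norm _).
- have : `|0 - rnorm (simple_integral mu (s_ n) - I)| <= e by near: n.
  by rewrite sub0r normrN; exact: le_trans (ler_norm _).
Unshelve. all: by end_near. Qed.

Lemma is_bochner_integral_norm f I : simple_limit mu f ->
  is_bochner_integral mu f I -> ((rnorm I)%:E <= L1_norm mu f)%E.
Proof.
move=> fP fI; apply/lee_addgt0Pr => e e0.
have [s [ms fs sI]] := simple_approximation fP fI (divr_gt0 e0 (ltr0Sn R 1)).
have sP := simple_limit_simple ms.
have Is : ((rnorm I)%:E <= (rnorm (simple_integral mu s))%:E + (e / 2)%:E)%E.
  rewrite -EFinD lee_fin; have := ler_rnormB (simple_integral mu s)
    (simple_integral mu s - I).
  by rewrite subKr => /le_trans; apply; rewrite lerD2l.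
apply: le_trans Is _; rewrite [in leRHS](splitr e) EFinD addeA leeD2r//.
apply: le_trans (le_rnorm_simple_integral ms) _.
have := L1_normB fP (simple_limitB fP sP).
under [X in (X <= _)%E -> _]eq_integral do rewrite subKr.
by move=> /le_trans; apply; rewrite leeD2l.
Qed.

Lemma is_bochner_integral_linear (c : R[i]) f g I J :
  simple_limit mu f -> simple_limit mu g ->
  is_bochner_integral mu f I -> is_bochner_integral mu g J ->
  is_bochner_integral mu (fun t => c *: f t + g t) (c *: I + J).
Proof.
move=> fP gP [s_ [ms sf s1 sI]] [r_ [mr rg r1 rJ]].
exists (fun n t => c *: s_ n t + r_ n t); split.
- by move=> n; have [] := simple_integral_linear c (ms n) (mr n).
- by apply: filterS2 sf rg => t sft rgt; apply: cvgD => //; exact: cvgZr.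
- apply: (@squeeze_cvge _ _ _ _ (cst 0%E) _ (fun n =>
    (normc c)%:E * L1_norm mu (fun t => f t - s_ n t)%R +
     L1_norm mu (fun t => g t - r_ n t)%R)%E).
  + apply: nearW => n; rewrite integral_ge0 => [|t _]; last first.
      by rewrite lee_fin rnorm_ge0.
    have := L1_norm_linear c (simple_limitB fP (simple_limit_simple (ms n)))
      (simple_limitB gP (simple_limit_simple (mr n))).
    move=> /(le_trans _) -> //; apply: ge0_integral_mono => t.
      by rewrite lee_fin rnorm_ge0.
    by rewrite scalerBr opprD addrACA.
  + exact: cvg_cst.
  + rewrite -[X in _ --> X]adde0 -[X in _ --> (X + _)%E](mule0 (normc c)%:E).
    by apply: cvgeD => //; apply: cvgeZl.
- rewrite (_ : (fun n => _) = fun n =>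
      c *: simple_integral mu (s_ n) + simple_integral mu (r_ n)).
    by apply: cvgD => //; exact: cvgZr.
  by apply/funext => n; have [] := simple_integral_linear c (ms n) (mr n).
Qed.

(** The difference of two integrals of [f] is an integral of the zero function, so the norm bound
    makes it 0. *)
Lemma is_bochner_integral_unique f I J : simple_limit mu f ->
  is_bochner_integral mu f I -> is_bochner_integral mu f J -> I = J.
Proof.
move=> fP fI fJ; have := is_bochner_integral_linear (-1) fP fP fJ fI.
rewrite scaleN1r addrC => /is_bochner_integral_norm H.
have : ((rnorm (I - J))%:E <= 0)%E.
  apply: le_trans (H _) _; first exact: simple_limit_linear.
  rewrite /L1_norm (_ : (fun t => _) = cst 0%E) ?integral0//.
  by apply/funext => t; rewrite scaleN1r addrC subrr rnorm0.
by rewrite lee_fin le_eqVlt ltNge rnorm_ge0 orbF rnorm_eq0 subr_eq0 => /eqP.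
Qed.

End properties.

Lemma is_bochner_integral_map (X Y : normedModType R[i]) (f : T -> X) (I : X)
    (S : X -> Y) (M : R) : linear S -> (forall x, rnorm (S x) <= M * rnorm x) ->
  simple_limit mu f -> is_bochner_integral mu f I ->
  is_bochner_integral mu (S \o f) (S I).
Proof.
move=> linS boundS fP [s_ [ms sf s1 sI]].
pose mS := GRing.isLinear.Build R[i] X Y *:%R S linS.
pose S' : {linear X -> Y} := HB.pack S mS.
have SE : S = S' by [].
have contS (h : nat -> X) x : h n @[n --> \oo] --> x -> S (h n) @[n --> \oo] --> S x.
  move=> /cvg_rnormP hx; apply/cvg_rnormP.
  apply: (@squeeze_cvgr _ _ _ _ (cst 0) (fun n => M * rnorm (h n - x))).
  - by apply: nearW => n /=; rewrite rnorm_ge0 SE -raddfB boundS.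
  - exact: cvg_cst.
  - by rewrite -[X in _ --> X](mulr0 M); apply: cvgMr.
have sm n : mu_simple mu (S \o s_ n) /\
    simple_integral mu (S \o s_ n) = S (simple_integral mu (s_ n)).
  have [fins mes oos] := ms n.
  have ooS x : S x != 0 -> (mu (s_ n @^-1` [set x]) < +oo)%E.
    by move=> Sx; apply: oos; apply: contra Sx => /eqP ->; rewrite SE raddf0.
  split; first exact: mu_simple_comp.
  rewrite simple_integral_comp// /simple_integral !fsbig_finite//= SE linear_sum.
  apply: eq_bigr => x _.
  by rewrite linearZ.
exists (fun n => S \o s_ n); split.
- by move=> n; have [] := sm n.
- by apply: filterS sf => t sft; exact: contS.
- apply: (@squeeze_cvge _ _ _ _ (cst 0%E) _ (fun n =>
    `|M|%:E * L1_norm mu (fun t => f t - s_ n t)%R)%E).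
  + apply: nearW => n; rewrite integral_ge0 => [|t _]; last first.
      by rewrite lee_fin rnorm_ge0.
    have mfs := measurable_rnorm_simple_limit
      (simple_limitB fP (simple_limit_simple (ms n))).
    rewrite /L1_norm -ge0_integralZl_EFin//; last 2 first.
    * by move=> t _; rewrite lee_fin rnorm_ge0.
    * exact/measurable_EFinP.
    apply: ge0_integral_mono => t; first by rewrite lee_fin rnorm_ge0.
    rewrite -EFinM lee_fin /= SE -raddfB (le_trans (boundS _))//.
    by rewrite ler_wpM2r ?rnorm_ge0// ler_norm.
  + exact: cvg_cst.
  + by rewrite -[X in _ --> X](mule0 `|M|%:E); apply: cvgeZl.
- rewrite (_ : (fun n => _) = fun n => S (simple_integral mu (s_ n))).
    exact: contS.
  by apply/funext => n; have [] := sm n.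
Qed.

Section existence.
Context (X : completeNormedModType R[i]).
Implicit Types (f g : T -> X).

(** Completeness of [X] enters here: the integrals of simple functions that approximate [f] in L1
    form a Cauchy sequence. Hence [bochner_integral] does not take its default value. *)
Lemma bochner_integrableP f : simple_limit mu f -> (L1_norm mu f < +oo)%E ->
  is_bochner_integral mu f (bochner_integral mu f).
Proof.
move=> fP oof; have [s_ [ms sf s1]] := simple_limit_L1 fP oof.
apply: xgetPex.
suff /cvg_ex[I sI] : cvg (simple_integral mu (s_ n) @[n --> \oo]).
  by exists I; exists s_; split=> //; exact: aeW.
apply: cauchy_cvg; apply: cauchy_exP => e e0.
have eE : e = (complex.Re e)%:C%C.
  by move: e0; case: (e) => a b; rewrite ltcE /= => /andP[/eqP ->].
have {}e0 : 0 < complex.Re e / 2 by rewrite divr_gt0//; move: e0; rewrite eE ltcR.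
have /fine_cvgP[fin1 /cvgrPdist_lt/(_ _ e0) near1] := s1.
have near2 : \forall n \near \oo,
    (L1_norm mu (fun t => f t - s_ n t)%R < (complex.Re e / 2)%:E)%E.
  near=> n; rewrite -[X in (X < _)%E]fineK; last by near: n.
  rewrite lte_fin; have : `|0 - fine (L1_norm mu (fun t => f t - s_ n t))| <
    complex.Re e / 2 by near: n.
  by rewrite sub0r normrN; exact: le_lt_trans (ler_norm _).
have [N _ HN] := near2.
exists (simple_integral mu (s_ N)); exists N => // n /= Nn.
rewrite -ball_normE /= rnormE eE ltcR -lte_fin.
apply: le_lt_trans (rnorm_simple_integralB (ms N) (ms n)) _.
have sP k : simple_limit mu (fun t => f t - s_ k t).
  by apply: simple_limitB => //; exact: simple_limit_simple.
have := L1_normB (sP n) (sP N).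
under [X in (X <= _)%E -> _]eq_integral do rewrite opprB addrC addrA subrK.
move=> /le_lt_trans; apply; rewrite (splitr (complex.Re e)) EFinD.
by apply: lteD; [exact: HN|apply: HN => /=].
Unshelve. all: by end_near. Qed.

Lemma bochner_integralE f I : simple_limit mu f ->
  is_bochner_integral mu f I -> bochner_integral mu f = I.
Proof.
move=> fP fI; apply: (is_bochner_integral_unique fP _ fI).
by apply: xgetPex; exists I.
Qed.

End existence.

End bochner_integral.

(** * Lebesgue measure on phase space *)

Section boxes.
Context (R : realType).

Definition rV_box n (r : R) : set 'rV[R]_n := [set x | forall i, `|x ord0 i| <= r].

Lemma measurable_rV_box n r : measurable (@rV_box n r).
Proof.
have -> : @rV_box n r =
    \bigcap_(i in [set: 'I_n]) ((fun x : 'rV[R]_n => x ord0 i) @^-1` `[- r, r]).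
  apply/seteqP; split=> x /= xr i; first by rewrite /= in_itv /= -ler_norml.
  by have := xr i Logic.I; rewrite /= in_itv /= -ler_norml.
apply: fin_bigcap_measurable => // i _.
by rewrite -[X in measurable X]setTI; exact: measurable_rV_coord.
Qed.

Lemma lebesgue_rV_box n (r : R) : 0 <= r ->
  @lebesgue_rV R n (rV_box r) = ((r *+ 2) ^+ n)%:E.
Proof.
move=> r0; elim: n => [|n IH] /=.
  rewrite diracE expr0 mem_set// => i; by rewrite mxE normr0.
rewrite /pushforward (_ : _ @^-1` _ = `[- r, r]%classic `*` @rV_box n r); last first.
  apply/seteqP; split=> -[a v] /=.
    move=> H; split => [|i] /=.
      by have := H ord0; rewrite mxE unlift_none in_itv/= -ler_norml.
    by have := H (lift ord0 i); rewrite mxE liftK.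
  rewrite in_itv /= -ler_norml => -[ar vr] i; rewrite mxE.
  by case: unliftP => [j|] _ //; exact: vr.
transitivity (@lebesgue_measure R `[(- r)%R, r]%classic * @lebesgue_rV R n (rV_box r))%E.
  by apply: product_measure1E => //; exact: measurable_rV_box.
rewrite IH lebesgue_measure_itv /= lte_fin exprS.
case: ltP => [_|]; first by rewrite -EFinD opprK EFinM mulr2n.
by move=> rr; rewrite (_ : r = 0) ?mul0rn ?mul0e ?mul0r//; lra.
Qed.

Definition phase_box d (r : R) : set ('rV[R]_d * 'rV[R]_d) :=
  rV_box r `*` rV_box r.

Lemma measurable_phase_box d r : measurable (@phase_box d r).
Proof. by apply: measurableX; exact: measurable_rV_box. Qed.

Lemma lebesgue_phase_box d (r : R) : 0 <= r ->
  @lebesgue_phase R d (phase_box r) = ((r *+ 2) ^+ (d + d))%:E.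
Proof.
move=> r0.
transitivity (@lebesgue_rV R d (rV_box r) * @lebesgue_rV R d (rV_box r))%E.
  by apply: product_measure1E => //; exact: measurable_rV_box.
by rewrite !lebesgue_rV_box// -EFinM exprD.
Qed.

Lemma phase_boxB d (r s : R) z w :
  @phase_box d r z -> @phase_box d s w -> @phase_box d (r + s) (z - w).
Proof.
move=> [z1 z2] [w1 w2]; split=> i /=; rewrite !mxE.
  by rewrite (le_trans (ler_normB _ _))// lerD.
by rewrite (le_trans (ler_normB _ _))// lerD.
Qed.

End boxes.

(** * Translation invariance of the Lebesgue measure on phase space *)

Section translation.
Context (R : realType).

(** The image of the Lebesgue measure under the translation gives half-open intervals their length,
    and this property characterizes the Lebesgue measure. *)
Lemma ge0_integral_lebesgue_translate (a : R) (f : measurableTypeR R -> \bar R) :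
  measurable_fun setT f -> (forall x, 0 <= f x)%E ->
  (\int[lebesgue_measure]_x f (x + a)%R = \int[lebesgue_measure]_x f x)%E.
Proof.
move=> mf f0.
pose tr : measurableTypeR R -> measurableTypeR R := fun x => x + a.
have mtr : measurable_fun setT tr by exact: measurable_funD.
have [nu nuE] : exists nu : {measure set (measurableTypeR R) -> \bar R},
    nu = pushforward (@lebesgue_measure R) tr :> (set _ -> \bar R).
  by unshelve (eexists [the measure _ _ of pushforward (@lebesgue_measure R) tr]).
have E A : measurable A -> lebesgue_measure A = nu A.
  apply: lebesgue_measure_unique => _ [[b c] /= bc <-].
  rewrite nuE /pushforward (_ : _ @^-1` _ = `](b - a), (c - a)]%classic).
    rewrite !lebesgue_measure_itv /= !lte_fin ltrD2r.
    by case: ifPn => // _; rewrite -!EFinD; congr EFin; ring.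
  by apply/seteqP; split=> x; rewrite /tr /= !in_itv /= lerBrDr ltrBlDr.
transitivity (\int[nu]_x f x)%E; last first.
  by apply: eq_measure_integral => A mA _; apply/esym; exact: E.
by rewrite nuE ge0_integral_pushforward.
Qed.

Lemma measurable_rV_translate n (t : 'rV[R]_n) :
  measurable_fun setT (fun x : 'rV[R]_n => x + t).
Proof.
apply: measurable_fun_rV => i; under eq_fun do rewrite mxE.
by apply: measurable_funD => //; exact: measurable_rV_coord.
Qed.

Lemma ge0_integral_rV_consE n (f : 'rV[R]_n.+1 -> \bar R) :
  measurable_fun setT f -> (forall x, 0 <= f x)%E ->
  (\int[@lebesgue_rV R n.+1]_x f x =
   \int[@lebesgue_measure R]_x \int[@lebesgue_rV R n]_v f (rV_cons (x, v)))%E.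
Proof.
move=> mf f0.
transitivity (\int[lebesgue_measure \x @lebesgue_rV R n]_p f (rV_cons p))%E.
  exact: (@ge0_integral_pushforward _ _ _ _ _ _ (@measurable_rV_cons R n)
    [the measure _ _ of (lebesgue_measure \x @lebesgue_rV R n)%E] setT f
    measurableT mf (fun x _ => f0 x)).
by rewrite fubini_tonelli1//; exact: measurableT_comp (@measurable_rV_cons R n).
Qed.

Lemma ge0_integral_rV_translate n (t : 'rV[R]_n) (f : 'rV[R]_n -> \bar R) :
  measurable_fun setT f -> (forall x, 0 <= f x)%E ->
  (\int[@lebesgue_rV R n]_x f (x + t)%R = \int[@lebesgue_rV R n]_x f x)%E.
Proof.
elim: n => [|n IH] in t f *.
  by move=> _ _; apply: eq_integral => x _; rewrite [t]thinmx0 addr0.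
move=> mf f0.
have mfc : measurable_fun setT (fun p => f (@rV_cons R n p)).
  exact: measurableT_comp (@measurable_rV_cons R n).
rewrite ge0_integral_rV_consE//; last first.
  exact: measurableT_comp (measurable_rV_translate t).
rewrite ge0_integral_rV_consE// -[RHS](@ge0_integral_lebesgue_translate (t ord0 ord0)).
- apply: eq_integral => x _; pose t' : 'rV[R]_n := \row_i t ord0 (lift ord0 i).
  rewrite -[RHS](IH t')//; last exact: (measurableT_comp mfc (measurable_pair1 _)).
  apply: eq_integral => v _; congr f; apply/rowP => i; rewrite !mxE.
  by case: unliftP => [j|] ->; rewrite ?mxE.
- exact: (measurable_fun_fubini_tonelli_F (m2 := @lebesgue_rV R n) _ mfc).
- by move=> x; apply: integral_ge0.
Qed.

Lemma measurable_phase_translate d (t : 'rV[R]_d * 'rV[R]_d) :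
  measurable_fun setT (fun z : 'rV[R]_d * 'rV[R]_d => z + t).
Proof.
apply: measurable_fun_pair.
  exact: measurableT_comp (measurable_rV_translate t.1) measurable_fst.
exact: measurableT_comp (measurable_rV_translate t.2) measurable_snd.
Qed.

Lemma integral_phase_translate d (t : 'rV[R]_d * 'rV[R]_d)
    (f : 'rV[R]_d * 'rV[R]_d -> \bar R) : measurable_fun setT f ->
  (\int[@lebesgue_phase R d]_z f (z + t)%R = \int[@lebesgue_phase R d]_z f z)%E.
Proof.
have ge0 (g : 'rV[R]_d * 'rV[R]_d -> \bar R) : measurable_fun setT g ->
    (forall z, 0 <= g z)%E ->
    (\int[@lebesgue_phase R d]_z g (z + t)%R = \int[@lebesgue_phase R d]_z g z)%E.
  move=> mg g0; have mgt := measurableT_comp mg (measurable_phase_translate t).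
  rewrite /lebesgue_phase.
  rewrite (@fubini_tonelli1 _ _ _ _ _ (@lebesgue_rV R d) (@lebesgue_rV R d))//.
  rewrite (@fubini_tonelli1 _ _ _ _ _ (@lebesgue_rV R d) (@lebesgue_rV R d))//.
  rewrite -[RHS](@ge0_integral_rV_translate _ t.1).
  - apply: eq_integral => x _; rewrite -[RHS](@ge0_integral_rV_translate _ t.2)//.
    exact: (measurableT_comp mg (measurable_pair1 _)).
  - exact: (measurable_fun_fubini_tonelli_F (m2 := @lebesgue_rV R d) _ mg).
  - by move=> x; apply: integral_ge0.
move=> mf; rewrite integralE [RHS]integralE.
have -> := funepos_comp f (fun z => z + t).
have -> := funeneg_comp f (fun z => z + t).
by congr (_ - _)%E; apply: ge0 => //;
  [exact: measurable_funepos|exact: measurable_funeneg].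
Qed.

End translation.

(** * An integrable weight comparable to its translates *)

Section weight.
Context (R : realType).

Definition rV_weight n (u : 'rV[R]_n) : R := \prod_(i < n) (oneDsqr (u ord0 i))^-1.

Definition phase_weight d (z : 'rV[R]_d * 'rV[R]_d) : R :=
  rV_weight z.1 * rV_weight z.2.

Lemma oneDsqr_gt0 (x : R) : 0 < oneDsqr x.
Proof. exact: lt_le_trans ltr01 (oneDsqr_ge1 x). Qed.

Lemma oneDsqrV_ge0 (x : R) : 0 <= (oneDsqr x)^-1.
Proof. by rewrite invr_ge0 ltW// oneDsqr_gt0. Qed.

Lemma measurable_oneDsqrV :
  measurable_fun setT (fun x : measurableTypeR R => (oneDsqr x)^-1).
Proof. by apply: continuous_measurable_fun; exact: continuous_oneDsqrV. Qed.

Lemma rV_weight_gt0 n (u : 'rV[R]_n) : 0 < rV_weight u.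
Proof. by apply: prodr_gt0 => i _; rewrite invr_gt0 oneDsqr_gt0. Qed.

Lemma phase_weight_gt0 d (z : 'rV[R]_d * 'rV[R]_d) : 0 < phase_weight z.
Proof. by rewrite mulr_gt0 ?rV_weight_gt0. Qed.

Lemma measurable_rV_weight n : measurable_fun setT (@rV_weight n).
Proof.
apply: measurable_prod => i _.
exact: (measurableT_comp measurable_oneDsqrV (measurable_rV_coord i)).
Qed.

Lemma measurable_phase_weight d : measurable_fun setT (@phase_weight d).
Proof.
apply: measurable_funM.
  exact: (measurableT_comp (measurable_rV_weight (n := d)) measurable_fst).
exact: (measurableT_comp (measurable_rV_weight (n := d)) measurable_snd).
Qed.

Lemma integral_oneDsqrV_lty :
  (\int[@lebesgue_measure R]_x ((oneDsqr x)^-1)%:E < +oo)%E.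
Proof.
rewrite ge0_symfun_integralT//.
- by rewrite -set_itvcy integral0y_oneDsqr -EFinM ltry.
- exact: continuous_oneDsqrV.
- by move=> x; rewrite /= /oneDsqr sqrrN.
Qed.

Lemma integral_rV_weight_lty n :
  (\int[@lebesgue_rV R n]_u (rV_weight u)%:E < +oo)%E.
Proof.
elim: n => [|n IH].
  rewrite integral_dirac//; last by apply/measurable_EFinP; exact: measurable_rV_weight.
  by rewrite diracT mul1e ltry.
have weightE x v : rV_weight (rV_cons (x, v)) = (oneDsqr x)^-1 * @rV_weight n v.
  rewrite /rV_weight big_ord_recl; congr (_ * _); first by rewrite mxE unlift_none.
  by apply: eq_bigr => i _; rewrite mxE liftK.
have int_ge0 : (0 <= \int[@lebesgue_rV R n]_u (rV_weight u)%:E)%E.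
  by apply: integral_ge0 => u _; rewrite lee_fin ltW// rV_weight_gt0.
rewrite ge0_integral_rV_consE; last 2 first.
- by apply/measurable_EFinP; exact: measurable_rV_weight.
- by move=> u; rewrite lee_fin ltW// rV_weight_gt0.
under eq_integral => x _.
  under eq_integral do rewrite weightE EFinM.
  rewrite ge0_integralZl_EFin//; last 2 first.
  - by move=> u _; rewrite lee_fin ltW// rV_weight_gt0.
  - by apply/measurable_EFinP; exact: measurable_rV_weight.
  over.
rewrite /= ge0_integralZr//; last first.
  by apply/measurable_EFinP; exact: measurable_oneDsqrV.
have int1_ge0 : (0 <= \int[@lebesgue_measure R]_x ((oneDsqr x)^-1)%:E)%E.
  by apply: integral_ge0 => x _; rewrite lee_fin oneDsqrV_ge0.
apply: lte_mul_pinfty; [exact: int1_ge0| |exact: IH].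
by rewrite ge0_fin_numE// integral_oneDsqrV_lty.
Qed.

Lemma integrable_phase_weight d :
  (@lebesgue_phase R d).-integrable setT (EFin \o @phase_weight d).
Proof.
apply/integrableP; split; first by apply/measurable_EFinP; exact: measurable_phase_weight.
have wge0 n (u : 'rV[R]_n) : (0 <= (rV_weight u)%:E)%E by rewrite lee_fin ltW// rV_weight_gt0.
have mw n : measurable_fun setT (fun u => (@rV_weight n u)%:E).
  by apply/measurable_EFinP; exact: measurable_rV_weight.
under eq_integral do rewrite gee0_abs ?lee_fin ?ltW ?phase_weight_gt0//.
rewrite /lebesgue_phase.
rewrite (@fubini_tonelli1 _ _ _ _ _ (@lebesgue_rV R d) (@lebesgue_rV R d))/=; last 2 first.
- by apply/measurable_EFinP; exact: measurable_phase_weight.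
- by move=> x; rewrite lee_fin ltW// phase_weight_gt0.
rewrite /fubini_F; under eq_integral => x _.
  under eq_integral do rewrite /phase_weight /= EFinM.
  rewrite ge0_integralZl_EFin//; [|exact: mw|exact/ltW/rV_weight_gt0].
  over.
rewrite /= ge0_integralZr//; [|exact: mw|exact: integral_ge0].
apply: lte_mul_pinfty; [exact: integral_ge0| |exact: integral_rV_weight_lty].
by rewrite ge0_fin_numE ?integral_rV_weight_lty//; exact: integral_ge0.
Qed.

Lemma oneDsqr_translate (x t : R) : `|t| <= 1 ->
  (oneDsqr (x + t))^-1 <= 3 * (oneDsqr x)^-1.
Proof.
move=> t1; rewrite ler_pdivlMr ?oneDsqr_gt0// mulrC ler_pdivrMr ?oneDsqr_gt0//.
rewrite /oneDsqr; have : t ^+ 2 <= 1 by rewrite -real_normK ?num_real// expr_le1.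
(* With y = x + t, x^2 = 2 y^2 + 2 t^2 - (y + t)^2 <= 2 y^2 + 2, so 1 + x^2 <= 3 (1 + y^2). *)
have := sqr_ge0 (x + t + t); nra.
Qed.

Lemma rV_weight_translate n (u t : 'rV[R]_n) : rV_box 1 t ->
  rV_weight (u + t) <= 3 ^+ n * rV_weight u.
Proof.
move=> t1; rewrite -[X in 3 ^+ X]card_ord -prodr_const -big_split/=.
apply: ler_prod => i _; rewrite mxE invr_ge0 ltW ?oneDsqr_gt0//=.
exact: oneDsqr_translate.
Qed.

Lemma phase_weight_translate d (z t : 'rV[R]_d * 'rV[R]_d) : phase_box 1 t ->
  phase_weight (z + t) <= 3 ^+ (d + d) * phase_weight z.
Proof.
move=> [t1 t2]; rewrite exprD /phase_weight mulrACA.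
by apply: ler_pM; [exact/ltW/rV_weight_gt0|exact/ltW/rV_weight_gt0|
  exact: rV_weight_translate|exact: rV_weight_translate].
Qed.

End weight.

(** * Continuous functions on phase space as everywhere limits of simple functions *)

Section discretization.
Context (R : realType) (d : nat) (X : normedModType R[i]).
Local Notation E := ('rV[R]_d * 'rV[R]_d)%type.

Lemma rV_norm_le n (x : 'rV[R]_n) (e : R) : 0 <= e ->
  (forall i, `|x ord0 i| <= e) -> `|x| <= e.
Proof.
move=> e0 xe; have [/eqP|/mx_norm_neq0[[i j] /= xE]] := boolP (mx_norm x == 0).
  by rewrite /Num.norm /= => ->.
by rewrite /Num.norm /= xE (ord1 i).
Qed.

Lemma near_phase_box (z : E) : \forall n \near \oo, phase_box n%:R z.
Proof.
have : \forall n \near \oo, `|z| <= n%:R :> R by exact: nbhs_infty_ger.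
apply: filterS => n; rewrite prod_normE ge_max => /andP[z1 z2].
by split=> i; [apply: le_trans z1|apply: le_trans z2];
  rewrite /Num.norm /= mx_normrE; apply/bigmax_geP; right; exists (ord0, i).
Qed.

(* The box [-n, n]^(2d) is cut into cubes of side [1 / n.+1], numbered in each
   direction from the left; [None] stands for the complement of the box. *)
Let N (n : nat) : R := n.+1%:R.
Let card (n : nat) := (2 * (n * n.+1))%N.
Let cell n (x : R) : 'I_(card n).+1 := inord (Num.truncn ((x + n%:R) * N n)).
Let corner n (k : 'I_(card n).+1) : R := (k : nat)%:R / N n - n%:R.
Let code n : Type := ('rV['I_(card n).+1]_d * 'rV['I_(card n).+1]_d)%type.

Let N_gt0 n : 0 < N n. Proof. exact: ltr0Sn. Qed.

(** The endpoint x = n falls in the cell numbered [card n], hence one index more than the number of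
    intervals of side 1/(n+1). Under this bound [inord] in [cell] does not fall back on its
    default. *)
Let cell_le n (x : R) : `|x| <= n%:R -> (Num.truncn ((x + n%:R) * N n) < (card n).+1)%N.
Proof.
rewrite ler_norml => /andP[x1 x2]; rewrite truncn_lt_nat.
  have -> : (card n).+1%:R = 2 * n%:R * N n + 1 by rewrite -addn1 natrD !natrM mulrA.
  by have := N_gt0 n; nra.
by rewrite mulr_ge0 ?ler0n//; lra.
Qed.

(** The cells are half-open intervals, from which the measurability of the fibres of [encode] and
    the bound on the rounding error both follow. *)
Let cellP n (x : R) (k : 'I_(card n).+1) : `|x| <= n%:R ->
  (cell n x == k) = (corner k <= x < corner k + (N n)^-1).
Proof.
move=> xn; have y0 : 0 <= (x + n%:R) * N n.
  by rewrite mulr_ge0 ?ler0n//; move: xn; rewrite ler_norml => /andP[]; lra.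
have -> : (cell n x == k) = (Num.truncn ((x + n%:R) * N n) == k).
  by rewrite -val_eqE /= inordK// cell_le.
rewrite truncn_eq// /corner -ler_pdivrMr// -ltr_pdivlMr// lerBlDr.
by rewrite -natr1 mulrDl mul1r addrAC ltrBrDr.
Qed.

Let corner_cell n (x : R) : `|x| <= n%:R -> `|corner (cell n x) - x| <= (N n)^-1.
Proof.
move=> xn; have := cellP (cell n x) xn; rewrite eqxx => /esym/andP[].
rewrite ler_norml; have := N_gt0 n; rewrite -invr_gt0.
move: (corner _) (N n)^-1 => c e e0 c1 c2; apply/andP; split; lra.
Qed.

Let quantize n (k : code n) : E :=
  (\row_i corner (k.1 ord0 i), \row_i corner (k.2 ord0 i)).

Let encode n (z : E) : option (code n) :=
  if z \in phase_box n%:R then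
    Some (\row_i cell n (z.1 ord0 i), \row_i cell n (z.2 ord0 i))
  else None.

Let quantize_encode n (z : E) : phase_box n%:R z ->
  exists2 k, encode n z = Some k & `|quantize k - z| <= (N n)^-1.
Proof.
move=> zn; rewrite /encode mem_set//; eexists; first reflexivity.
have N0 : 0 <= (N n)^-1 by rewrite invr_ge0 ltW.
case: zn => z1 z2.
rewrite prod_normE ge_max; apply/andP; split; apply: rV_norm_le => // i.
  by rewrite !mxE corner_cell//; exact: z1.
by rewrite !mxE corner_cell//; exact: z2.
Qed.

Let measurable_encode n (k : option (code n)) :
  measurable (encode n @^-1` [set k]).
Proof.
case: k => [[k1 k2]|]; last first.
  rewrite (_ : _ @^-1` _ = ~` phase_box n%:R).
    by apply: measurableC; exact: measurable_phase_box.
  by apply/seteqP; split=> z; rewrite /encode /=; case: ifPn;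
    rewrite ?inE ?notin_setE.
pose S (k : 'rV['I_(card n).+1]_d) : set 'rV[R]_d := \bigcap_(i in [set: 'I_d])
  ((fun x : 'rV[R]_d => x ord0 i) @^-1` `[corner (k ord0 i), corner (k ord0 i) + (N n)^-1[).
have mS k : measurable (S k).
  apply: fin_bigcap_measurable => // i _.
  by rewrite -[X in measurable X]setTI; exact: measurable_rV_coord.
rewrite (_ : _ @^-1` _ = phase_box n%:R `&` (S k1 `*` S k2)).
  by apply: measurableI; [exact: measurable_phase_box|exact: measurableX].
apply/seteqP; split=> z; rewrite /encode /=.
  case: ifPn => //; rewrite inE => -[z1 z2] [<- <-].
  by do !split=> //; move=> i _; rewrite /= in_itv/= mxE -cellP.
move=> [[z1 z2] [S1 S2]]; rewrite mem_set//; congr (Some (_, _));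
  apply/rowP => i; rewrite mxE; apply/eqP; rewrite cellP//.
  by have := S1 i Logic.I; rewrite /= in_itv.
by have := S2 i Logic.I; rewrite /= in_itv.
Qed.

Lemma simple_limit_continuous (f : E -> X) : continuous f ->
  simple_limit (@lebesgue_phase R d) f.
Proof.
move=> cf; pose phi n (k : option (code n)) := if k is Some k then f (quantize k) else 0.
exists (fun n => phi n \o encode n); split=> [n|z].
  (* Each cube lies in a box of finite measure, while the complement of the box, of infinite measure
     in general, is sent to 0. *)
  apply: mu_simple_comp; [exact: finite_finset|exact: measurable_encode|].
  case=> [k _|]; last by rewrite /= eqxx.
  apply: (@le_lt_trans _ _ (@lebesgue_phase R d (phase_box n%:R))).
    apply: le_measure; rewrite ?inE; [exact: measurable_encode|exact: measurable_phase_box|].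
    by move=> z; rewrite /encode /=; case: ifPn => //; rewrite inE.
  by rewrite lebesgue_phase_box ?ler0n// ltry.
(* The value [z] is a filler for the finitely many [n] whose box misses [z]; from then on [q n] is a
   grid point within 1/(n+1) of [z]. *)
pose q n : E := if encode n z is Some k then quantize k else z.
have zbox := near_phase_box z.
have qz : q n @[n --> \oo] --> z.
  apply/cvgrPdist_le => e e0; have := near_infty_natSinv_lt (PosNum e0).
  move=> eN; near=> n; rewrite /q; have zn : phase_box n%:R z by near: n.
  have [k -> kz] := quantize_encode zn.
  by rewrite distrC (le_trans kz)// ltW//; near: n.
apply: (cvg_trans _ (continuous_cvg _ (cf z) qz)).
apply: near_eq_cvg; near=> n; rewrite /= /q.
have zn : phase_box n%:R z by near: n.
by have [k -> _] := quantize_encode zn.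
Unshelve. all: by end_near. Qed.

End discretization.

(** * Fourier transforms of Schwartz functions *)

Section weight_bounded.
Context (R : realType) (d : nat).
Local Notation E := ('rV[R]_d * 'rV[R]_d)%type.
Local Notation mu := (@lebesgue_phase R d).
Implicit Types (f h : E -> R).

Lemma rnorm_complex (c : R[i]) : rnorm (c : R[i]^o) = normc c.
Proof. by case: c. Qed.

Lemma normc_ge_Re (c : R[i]) : `|complex.Re c| <= normc c.
Proof.
case: c => a b /=; rewrite -sqrtr_sqr ler_wsqrtr// lerDl; exact: sqr_ge0.
Qed.

(** The sigma-algebra on row vectors is generated by the coordinates, not by the open sets. The
    bridge is the grid: [f] is the pointwise limit of the real parts of measurable simple
    functions. *)
Lemma measurable_continuous_phase f : continuous f -> measurable_fun setT f.
Proof.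
move=> cf; have cfC : continuous (fun z => (f z)%:C%C : R[i]^o).
  move=> z; apply/cvg_rnormP; have /cvgrPdist_lt fz := cf z.
  apply/cvgrPdist_lt => e /fz; apply: filterS => w.
  by rewrite sub0r normrN rnorm_complex -rmorphB normc_real normr_id distrC.
have [s_ [ms sf]] := simple_limit_continuous cfC.
apply: (@measurable_fun_cvg _ _ _ _ (fun n z => complex.Re (s_ n z))).
  move=> n _ B _; rewrite setTI; have [fins mes _] := ms n.
  exact: (measurable_simple_preimage ((@complex.Re R) @^-1` B) fins mes).
move=> z _; have /cvg_rnormP/cvgrPdist_lt sfz := sf z.
apply/cvgrPdist_lt => e /sfz; apply: filterS => n.
rewrite sub0r normrN ger0_norm ?rnorm_ge0// rnorm_complex => /(le_lt_trans _).
by apply; rewrite distrC (le_trans _ (normc_ge_Re _))// raddfB.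
Qed.

Definition weight_bounded f := exists M : R, forall z, `|f z| <= M * phase_weight z.

Lemma integrable_weight_bounded f : measurable_fun setT f -> weight_bounded f ->
  mu.-integrable setT (EFin \o f).
Proof.
move=> mf [M fM].
apply: (le_integrable measurableT _ _ (integrableZl measurableT M (integrable_phase_weight R d))).
  exact/measurable_EFinP.
move=> z _ /=; rewrite lee_fin normrM (gtr0_norm (phase_weight_gt0 z)).
by rewrite (le_trans (fM z))// ler_wpM2r ?ler_norm// ltW// phase_weight_gt0.
Qed.

Lemma weight_boundedD f h : weight_bounded f -> weight_bounded h ->
  weight_bounded (fun z => f z + h z).
Proof.
move=> [M fM] [K hK]; exists (M + K) => z.
by rewrite (le_trans (ler_normD _ _))// mulrDl lerD.
Qed.

Lemma weight_bounded_le f h (c : R) : weight_bounded f ->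
  (forall z, `|h z| <= c * `|f z|) -> weight_bounded h.
Proof.
move=> [M fM] hf; exists (`|c| * M) => z; rewrite (le_trans (hf z))// -mulrA.
by rewrite (le_trans (ler_wpM2r _ (ler_norm c)))// ler_wpM2l.
Qed.

(* [h] is integrated against difference quotients in the direction [e], whose
   integral vanishes by translation invariance. *)
Lemma integral_line_derivative (e : E) (h dh : E -> R) :
  phase_box 1 e -> measurable_fun setT h -> weight_bounded h -> weight_bounded dh ->
  (forall z (t : R), is_derive t 1 (fun s : R => h (z + s *: e)) (dh (z + t *: e))) ->
  \int[mu]_z dh z = 0.
Proof.
move=> e1 mh hw [M dhM] hdh.
pose q n z := n.+1%:R * (h (z + n.+1%:R^-1 *: e) - h z).
have mq n : measurable_fun setT (q n).
  apply: measurable_funM => //; apply: measurable_funB => //.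
  exact: (measurableT_comp mh (measurable_phase_translate _)).
have q0 n : (\int[mu]_z (q n z)%:E = 0)%E.
  have ih := integrable_weight_bounded mh hw.
  have iht : mu.-integrable setT (fun z => (h (z + n.+1%:R^-1 *: e))%:E).
    apply: (@integrable_weight_bounded (fun z => h (z + n.+1%:R^-1 *: e))).
      exact: (measurableT_comp mh (measurable_phase_translate _)).
    have [K hK] := hw; exists (`|K| * 3 ^+ (d + d)) => z.
    rewrite (le_trans (hK _))// (le_trans (ler_wpM2r _ (ler_norm K)))//.
      by rewrite ltW// phase_weight_gt0.
    rewrite -mulrA ler_wpM2l// phase_weight_translate//.
    case: e1 => e1 e2; split=> i; rewrite !mxE normrM.
      by rewrite mulr_ile1// normfV invf_le1 normr_nat ?ler1n.
    by rewrite mulr_ile1// normfV invf_le1 normr_nat ?ler1n.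
  under eq_integral do rewrite /q EFinM.
  rewrite integralZl//; last exact: (integrableB measurableT iht ih).
  under eq_integral do rewrite EFinB.
  rewrite integralB//.
  rewrite (integral_phase_translate (n.+1%:R^-1 *: e) (f := EFin \o h)).
    by rewrite subee ?mule0//; exact: integrable_fin_num.
  exact/measurable_EFinP.
have qdh z : q n z @[n --> \oo] --> dh z.
  have [dg dE] := hdh z 0; rewrite scale0r addr0 in dE.
  have : (fun t : R => t^-1 *: (((fun s : R => h (z + s *: e)) \o shift 0) (t *: 1) -
      h (z + 0 *: e))) @ 0^' --> dh z by rewrite -dE; exact: dg.
  move=> /cvgr_dnbhsP/(_ (fun n => n.+1%:R^-1)).
  rewrite /= scale0r addr0 => H; apply: cvg_trans (H _); last first.
    by split=> [n|]; [rewrite invr_eq0 pnatr_eq0|exact: cvg_harmonic].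
  apply: near_eq_cvg; apply: nearW => n.
  by rewrite /q /= invrK addr0 scaler1.
(* By the mean value theorem the difference quotient is a value of [dh] at [z + c *: e] with c <
   1/(n+1). This shift stays in the unit box, where the weight changes by at most 3^(2d). *)
have qM n z : `|q n z| <= `|M| * 3 ^+ (d + d) * phase_weight z.
  have n0 : 0 < n.+1%:R^-1 :> R by rewrite invr_gt0.
  have n1 : n.+1%:R^-1 <= 1 :> R by rewrite invf_le1// ler1n.
  have [|c /[!in_itv]/= /andP[c0 cn]] := MVT n0 (fun t _ => hdh z t).
    apply: continuous_subspaceT => t.
    by have [dg _] := hdh z t; exact/differentiable_continuous/derivable1_diffP.
  rewrite /q scale0r addr0 subr0 => ->.
  rewrite mulrCA mulfV ?pnatr_eq0// mulr1.
  rewrite (le_trans (dhM _))// (le_trans (ler_wpM2r _ (ler_norm M)))//.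
    by rewrite ltW// phase_weight_gt0.
  rewrite -mulrA ler_wpM2l// phase_weight_translate//.
  have c1 : `|c| <= 1 by rewrite gtr0_norm// (le_trans (ltW cn)).
  by case: e1 => e1 e2; split=> i; rewrite !mxE normrM mulr_ile1.
rewrite /Rintegral; have := @dominated_cvg _ _ _ mu setT measurableT
  (fun n z => (q n z)%:E) (fun z => (dh z)%:E)
  (fun z => (`|M| * 3 ^+ (d + d) * phase_weight z)%:E).
move=> /(_ _ _ _ _ _)/cvg_lim H; rewrite -H//.
- by under eq_fun do rewrite q0; rewrite lim_cst.
- by move=> n; exact/measurable_EFinP.
- by move=> z _; apply/fine_cvgP; split; [exact: nearW|exact: qdh].
- apply: (integrableZl measurableT (`|M| * 3 ^+ (d + d)) (integrable_phase_weight R d)).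
- by move=> n z _; rewrite lee_fin.
Qed.

End weight_bounded.

(** * Decay and continuity of cosine and sine transforms *)

Section rapid_decay.
Context (R : realType) (d : nat).
Local Notation E := ('rV[R]_d * 'rV[R]_d)%type.
Local Notation mu := (@lebesgue_phase R d).
Local Notation basis := (@phase_basis R d).
Implicit Types (f h : E -> R) (w z : E).

Definition rapid h := forall al : seq ('I_d + 'I_d), exists M : R, forall z,
  `|(\prod_(k <- al) phase_coord k z) * h z| <= M.

Lemma rapid_coord k h : rapid h -> rapid (fun z => phase_coord k z * h z).
Proof.
move=> rh al; have [M hM] := rh (k :: al); exists M => z.
by have := hM z; rewrite big_cons -mulrA mulrCA.
Qed.

Lemma phase_weightE z :
  phase_weight z = (\prod_(k : 'I_d + 'I_d) oneDsqr (phase_coord k z))^-1.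
Proof. by rewrite big_sumType /= invfM /phase_weight /rV_weight !prodfV. Qed.

Lemma rapid_weight_bounded h : rapid h -> weight_bounded h.
Proof.
move=> rh; suff [M hM] : exists M, forall z,
    `|(\prod_(k <- index_enum ('I_d + 'I_d)%type) oneDsqr (phase_coord k z)) *
      ((\prod_(k <- [::]) phase_coord k z) * h z)| <= M.
  exists M => z; rewrite phase_weightE ler_pdivlMr; last first.
    by apply: prodr_gt0 => k _; exact: oneDsqr_gt0.
  apply: le_trans (hM z); rewrite big_nil mul1r mulrC normrM ler_wpM2r//.
  exact: ler_norm.
(* The factors 1 + x_k^2 are expanded one coordinate at a time, and the monomial collected so far is
   generalized: the term 1 keeps [al], the term x_k^2 adds [k] to it twice. *)
move: [::]; elim: (index_enum _) => [|k s IH] al.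
  by have [M hM] := rh al; exists M => z; rewrite big_nil mul1r.
have [M1 h1] := IH al; have [M2 h2] := IH [:: k, k & al].
exists (M1 + M2) => z; rewrite big_cons {1}/oneDsqr.
apply: le_trans (lerD (h1 z) (h2 z)); apply: le_trans (ler_normD _ _).
by rewrite le_eqVlt; apply/orP; left; apply/eqP; congr (`|_|); rewrite !big_cons; ring.
Qed.

Lemma real_schwartz_rapid f s : real_schwartz f -> rapid (partials s f).
Proof. by move=> [_ fM] al; exact: fM. Qed.

Lemma real_schwartz_derive f k : real_schwartz f -> real_schwartz ('D_(basis k) f).
Proof.
have pE s : partials s ('D_(basis k) f) = partials (rcons s k) f.
  by rewrite /partials -cats1 foldr_cat.
move=> [sf fM]; split=> [s|al be]; rewrite pE; first exact: sf.
exact: fM.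
Qed.

Lemma real_schwartz_continuous f : real_schwartz f -> continuous f.
Proof. by move=> [sf _]; have [] := sf [::]. Qed.

Lemma is_derive_line f e z (t : R) : (forall z, derivable f z e) ->
  is_derive t 1 (fun s : R => f (z + s *: e)) ('D_e f (z + t *: e)).
Proof.
move=> df; have E1 : (fun s : R => s^-1 *: (((fun s : R => f (z + s *: e)) \o shift t)
    (s *: 1) - f (z + t *: e))) =
    (fun s : R => s^-1 *: ((f \o shift (z + t *: e)) (s *: e) - f (z + t *: e))).
  apply/funext => s /=; congr (_ *: (f _ - _)).
  have -> : s *: (1 : R^o) = s by rewrite /GRing.scale /= mulr1.
  by rewrite scalerDl addrCA.
split; first by rewrite /derivable E1; exact: df.
by rewrite /derive E1.
Qed.

Definition phase_dot z w : R := dotp z.1 w.1 + dotp z.2 w.2.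

Lemma dotpDl n (u v w : 'rV[R]_n) : dotp (u + v) w = dotp u w + dotp v w.
Proof. by rewrite /dotp -big_split; apply: eq_bigr => i _; rewrite mxE mulrDl. Qed.

Lemma dotpZl n (a : R) (u w : 'rV[R]_n) : dotp (a *: u) w = a * dotp u w.
Proof. by rewrite /dotp mulr_sumr; apply: eq_bigr => i _; rewrite mxE mulrA. Qed.

Lemma dotpC n (u v : 'rV[R]_n) : dotp u v = dotp v u.
Proof. by apply: eq_bigr => i _; rewrite mulrC. Qed.

Lemma dotp_delta n (j : 'I_n) (w : 'rV[R]_n) : dotp (delta_mx ord0 j) w = w ord0 j.
Proof.
rewrite /dotp (bigD1 j)//= mxE !eqxx mul1r big1 ?addr0// => i ij.
by rewrite mxE (negbTE ij) mul0r.
Qed.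

Lemma dotp0 n (w : 'rV[R]_n) : dotp 0 w = 0.
Proof. by apply: big1 => i _; rewrite mxE mul0r. Qed.

Lemma phase_dot_line k z w (t : R) :
  phase_dot (z + t *: basis k) w = phase_dot z w + t * phase_coord k w.
Proof.
rewrite /phase_dot /= !dotpDl !dotpZl addrACA -mulrDr; congr (_ + _ * _).
by case: k => j /=; rewrite dotp_delta dotp0 ?addr0 ?add0r.
Qed.

Lemma phase_box_basis k : phase_box 1 (basis k : E).
Proof.
case: k => j; split=> i; rewrite /= !mxE ?normr0//.
  by case: (_ && _); rewrite ?normr1 ?normr0.
by case: (_ && _); rewrite ?normr1 ?normr0.
Qed.

Lemma continuous_phase_coord k : continuous (@phase_coord R d k).
Proof.
case: k => j z.
  apply: (@continuous_comp _ _ _ fst (fun u : 'rV[R]_d => u ord0 j)).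
    exact: cvg_fst.
  exact: coord_continuous.
apply: (@continuous_comp _ _ _ snd (fun u : 'rV[R]_d => u ord0 j)).
  exact: cvg_snd.
exact: coord_continuous.
Qed.

Lemma continuous_phase_dot w : continuous (phase_dot^~ w).
Proof.
move=> z; rewrite /phase_dot /dotp.
apply: cvgD; apply: cvg_big => [|j _]; try exact: add_continuous.
  by apply: cvgMl; exact: (@continuous_phase_coord (inl j)).
by apply: cvgMl; exact: (@continuous_phase_coord (inr j)).
Qed.

Definition cos_transform f w : R := \int[mu]_z (f z * cos (phase_dot z w)).
Definition sin_transform f w : R := \int[mu]_z (f z * sin (phase_dot z w)).

Lemma continuous_mul_cos f w : continuous f ->
  continuous (fun z => f z * cos (phase_dot z w)).
Proof.
move=> cf z; apply: cvgM; first exact: cf.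
apply: (@continuous_comp _ _ _ (phase_dot^~ w) (@cos R)).
  exact: continuous_phase_dot.
exact: continuous_cos.
Qed.

Lemma continuous_mul_sin f w : continuous f ->
  continuous (fun z => f z * sin (phase_dot z w)).
Proof.
move=> cf z; apply: cvgM; first exact: cf.
apply: (@continuous_comp _ _ _ (phase_dot^~ w) (@sin R)).
  exact: continuous_phase_dot.
exact: continuous_sin.
Qed.

Lemma normr_mul_cos (a t : R) : `|a * cos t| <= `|a|.
Proof. by rewrite normrM ler_piMr// cos_max. Qed.

Lemma normr_mul_sin (a t : R) : `|a * sin t| <= `|a|.
Proof. by rewrite normrM ler_piMr// sin_max. Qed.

Lemma integrable_mul_cos f w : continuous f -> weight_bounded f ->
  mu.-integrable setT (EFin \o (fun z => f z * cos (phase_dot z w))).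
Proof.
move=> cf fw; apply: integrable_weight_bounded.
  by apply: measurable_continuous_phase; exact: continuous_mul_cos.
by apply: (weight_bounded_le (c := 1) fw) => z; rewrite mul1r normr_mul_cos.
Qed.

Lemma integrable_mul_sin f w : continuous f -> weight_bounded f ->
  mu.-integrable setT (EFin \o (fun z => f z * sin (phase_dot z w))).
Proof.
move=> cf fw; apply: integrable_weight_bounded.
  by apply: measurable_continuous_phase; exact: continuous_mul_sin.
by apply: (weight_bounded_le (c := 1) fw) => z; rewrite mul1r normr_mul_sin.
Qed.

(** Integration by parts: the derivatives of f cos and f sin in the direction [k] have integral 0 by
    [integral_line_derivative]. *)
Lemma transform_derive f k w : real_schwartz f ->
  cos_transform ('D_(basis k) f) w = phase_coord k w * sin_transform f w /\
  sin_transform ('D_(basis k) f) w = - (phase_coord k w * cos_transform f w).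
Proof.
move=> sf; have cf := real_schwartz_continuous sf.
have fw := rapid_weight_bounded (real_schwartz_rapid [::] sf).
have sDf := real_schwartz_derive k sf.
have cDf := real_schwartz_continuous sDf.
have Dfw := rapid_weight_bounded (real_schwartz_rapid [::] sDf).
have df z : derivable f z (basis k) by have [_] := sf.1 [::]; exact.
have lin z (t : R) : is_derive t 1 (fun s : R => phase_dot z w + s * phase_coord k w)
    (phase_coord k w).
  have := is_deriveD (is_derive_cst (phase_dot z w) t 1)
    (is_deriveM (is_derive_id t 1) (is_derive_cst (phase_coord k w) t 1)).
  by rewrite /GRing.scale /= mulr0 mulr1 !add0r.
have Hc : \int[mu]_z ('D_(basis k) f z * cos (phase_dot z w) -
    phase_coord k w * (f z * sin (phase_dot z w))) = 0.
  apply: (@integral_line_derivative _ _ (basis k)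
    (fun z => f z * cos (phase_dot z w))) => [||||z t].
  - exact: phase_box_basis.
  - by apply: measurable_continuous_phase; exact: continuous_mul_cos.
  - by apply: (weight_bounded_le (c := 1) fw) => z; rewrite mul1r normr_mul_cos.
  - apply: weight_boundedD.
      by apply: (weight_bounded_le (c := 1) Dfw) => z; rewrite mul1r normr_mul_cos.
    apply: (weight_bounded_le (c := `|phase_coord k w|) fw) => z.
    by rewrite normrN normrM ler_wpM2l// normr_mul_sin.
  - have -> : (fun s : R => f (z + s *: basis k) * cos (phase_dot (z + s *: basis k) w)) =
        (fun s : R => f (z + s *: basis k)) *
        (@cos R \o (fun s : R => phase_dot z w + s * phase_coord k w)).
      by apply/funext => s; rewrite phase_dot_line.
    apply: is_derive_eq.
      exact: is_deriveM (is_derive_line z t df)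
        (is_derive1_comp (is_derive_cos _) (lin z t)).
    by rewrite phase_dot_line /GRing.scale /=; ring.
have Hs : \int[mu]_z ('D_(basis k) f z * sin (phase_dot z w) +
    phase_coord k w * (f z * cos (phase_dot z w))) = 0.
  apply: (@integral_line_derivative _ _ (basis k)
    (fun z => f z * sin (phase_dot z w))) => [||||z t].
  - exact: phase_box_basis.
  - by apply: measurable_continuous_phase; exact: continuous_mul_sin.
  - by apply: (weight_bounded_le (c := 1) fw) => z; rewrite mul1r normr_mul_sin.
  - apply: weight_boundedD.
      by apply: (weight_bounded_le (c := 1) Dfw) => z; rewrite mul1r normr_mul_sin.
    apply: (weight_bounded_le (c := `|phase_coord k w|) fw) => z.
    by rewrite normrM ler_wpM2l// normr_mul_cos.
  - have -> : (fun s : R => f (z + s *: basis k) * sin (phase_dot (z + s *: basis k) w)) =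
        (fun s : R => f (z + s *: basis k)) *
        (@sin R \o (fun s : R => phase_dot z w + s * phase_coord k w)).
      by apply/funext => s; rewrite phase_dot_line.
    apply: is_derive_eq.
      exact: is_deriveM (is_derive_line z t df)
        (is_derive1_comp (is_derive_sin _) (lin z t)).
    by rewrite phase_dot_line /GRing.scale /=; ring.
have ifc := integrable_mul_cos w cf fw; have ifs := integrable_mul_sin w cf fw.
have iDc := integrable_mul_cos w cDf Dfw; have iDs := integrable_mul_sin w cDf Dfw.
split.
  move: Hc; rewrite RintegralB//; last exact: (integrableZl measurableT _ ifs).
  by rewrite RintegralZl// => /eqP; rewrite subr_eq0 => /eqP.
move: Hs; rewrite RintegralD//; last exact: (integrableZl measurableT _ ifc).
by rewrite RintegralZl// => /eqP; rewrite addr_eq0 => /eqP.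
Qed.

(** Each coordinate factor is absorbed by a derivative of [f], which is again Schwartz. This
    exchanges cosine and sine, so the two bounds are proved together, for all [f] at once. *)
Lemma rapid_transform f : real_schwartz f ->
  rapid (cos_transform f) /\ rapid (sin_transform f).
Proof.
move=> sf; suff H al : forall f, real_schwartz f ->
    (exists M : R, forall w, `|(\prod_(k <- al) phase_coord k w) * cos_transform f w| <= M) /\
    (exists M : R, forall w, `|(\prod_(k <- al) phase_coord k w) * sin_transform f w| <= M).
  by split=> al; have [] := H al f sf.
elim: al => [|k al IH] {sf}f sf.
  have cf := real_schwartz_continuous sf.
  have fw := rapid_weight_bounded (real_schwartz_rapid [::] sf).
  have iabs : mu.-integrable setT (EFin \o (fun z => `|f z|)).
    have := integrable_weight_bounded (measurable_continuous_phase cf) fw.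
    by move/integrable_abse.
  split; exists (\int[mu]_z `|f z|) => w; rewrite big_nil mul1r.
    have ic := integrable_mul_cos w cf fw.
    apply: le_trans (le_normr_Rintegral measurableT ic) _.
    apply: le_Rintegral => // [|z _]; last exact: normr_mul_cos.
    by have := integrable_abse ic.
  have is_ := integrable_mul_sin w cf fw.
  apply: le_trans (le_normr_Rintegral measurableT is_) _.
  apply: le_Rintegral => // [|z _]; last exact: normr_mul_sin.
  by have := integrable_abse is_.
have [[M1 h1] [M2 h2]] := IH _ (real_schwartz_derive k sf).
split; [exists M2 => w; have := h2 w|exists M1 => w; have := h1 w];
  have [Ec Es] := transform_derive k w sf; rewrite ?Ec ?Es big_cons ?mulrN ?normrN;
  by rewrite mulrA [_ * phase_coord k w]mulrC.
Qed.

Lemma phase_coord_le k w : `|phase_coord k w| <= `|w|.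
Proof.
rewrite prod_normE le_max; apply/orP.
by case: k => j /=; [left|right];
  rewrite [leRHS]mx_normrE; apply/bigmax_geP; right; exists (ord0, j).
Qed.

Lemma phase_dotE z w : phase_dot z w = \sum_k phase_coord k z * phase_coord k w.
Proof. by rewrite big_sumType. Qed.

Lemma phase_dotB z w w' :
  `|phase_dot z w - phase_dot z w'| <= `|w - w'| * \sum_k `|phase_coord k z|.
Proof.
rewrite !phase_dotE -sumrB mulr_sumr; apply: le_trans (ler_norm_sum _ _ _) _.
apply: ler_sum => k _; rewrite -mulrBr normrM mulrC ler_wpM2r//.
suff -> : phase_coord k w - phase_coord k w' = phase_coord k (w - w').
  exact: phase_coord_le.
by case: k => j /=; rewrite !mxE.
Qed.

Lemma ler_dist_cos (x y : R) : `|cos x - cos y| <= `|x - y|.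
Proof.
wlog xy : x y / x < y.
  move=> H; case: (ltgtP x y) => [/H//|/H|->]; last by rewrite !subrr.
  by rewrite distrC [leRHS]distrC.
have [c _ cE] := MVT xy (fun x _ => is_derive_cos x)
  (continuous_subspaceT (@continuous_cos R)).
by rewrite distrC cE [leRHS]distrC normrM ler_piMl// normrN sin_max.
Qed.

Lemma ler_dist_sin (x y : R) : `|sin x - sin y| <= `|x - y|.
Proof.
wlog xy : x y / x < y.
  move=> H; case: (ltgtP x y) => [/H//|/H|->]; last by rewrite !subrr.
  by rewrite distrC [leRHS]distrC.
have [c _ cE] := MVT xy (fun x _ => is_derive_sin x)
  (continuous_subspaceT (@continuous_sin R)).
by rewrite distrC cE [leRHS]distrC normrM ler_piMl// cos_max.
Qed.

Lemma weight_bounded_coord_sum f : real_schwartz f ->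
  weight_bounded (fun z => f z * \sum_k `|phase_coord k z|).
Proof.
move=> sf; suff H (s : seq ('I_d + 'I_d)) :
    weight_bounded (fun z => f z * \sum_(k <- s) `|phase_coord k z|) by exact: H.
elim: s => [|k s IH].
  by exists 0 => z; rewrite big_nil mulr0 mul0r normr0.
have -> : (fun z => f z * \sum_(k <- k :: s) `|phase_coord k z|) =
    (fun z => f z * `|phase_coord k z| + f z * \sum_(k <- s) `|phase_coord k z|).
  by apply/funext => z; rewrite big_cons mulrDr.
apply: weight_boundedD => //.
have kw := rapid_weight_bounded (rapid_coord k (real_schwartz_rapid [::] sf)).
apply: (weight_bounded_le (c := 1) kw) => z.
by rewrite mul1r !normrM normr_id mulrC.
Qed.

Lemma continuous_lipschitz (g : E -> R) (C : R) :
  (forall w w', `|g w - g w'| <= C * `|w - w'|) -> continuous g.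
Proof.
move=> gC w; apply/cvgrPdist_le => e e0.
have C0 : 0 < `|C| + 1 by rewrite ltr_wpDl.
have /cvgrPdist_le/(_ (e / (`|C| + 1))) : id @ w --> w by [].
move=> /(_ (divr_gt0 e0 C0)); apply: filterS => w' /= ww'.
apply: le_trans (gC _ _) _; rewrite ler_pdivlMr// in ww'.
apply: le_trans ww'; rewrite mulrC ler_wpM2l//.
by rewrite (le_trans (ler_norm C))// lerDl.
Qed.

(** Here [k] stands for [cos] or [sin]. The Lipschitz constant is the integral of |f(z)| times the
    sum of the |z_j|, finite because the coordinates times [f] still decay rapidly. *)
Lemma transform_lipschitz f (k : R -> R) : real_schwartz f ->
  continuous k -> (forall t, `|k t| <= 1) -> (forall x y, `|k x - k y| <= `|x - y|) ->
  continuous (fun w => \int[mu]_z (f z * k (phase_dot z w))).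
Proof.
move=> sf ck k1 kL; pose G z := f z * \sum_k `|phase_coord k z|.
have cf := real_schwartz_continuous sf.
have fw := rapid_weight_bounded (real_schwartz_rapid [::] sf).
have cG : continuous G.
  move=> z; apply: cvgM; first exact: cf.
  apply: cvg_big => [|j _]; first exact: add_continuous.
  by apply: cvg_norm; exact: continuous_phase_coord.
have iG : mu.-integrable setT (EFin \o G).
  apply: integrable_weight_bounded; first exact: measurable_continuous_phase.
  exact: weight_bounded_coord_sum.
have iGa : mu.-integrable setT (EFin \o (fun z => `|G z|)) by have := integrable_abse iG.
have ik w : mu.-integrable setT (EFin \o (fun z => f z * k (phase_dot z w))).
  apply: integrable_weight_bounded.
    apply: measurable_continuous_phase => z; apply: cvgM; first exact: cf.
    apply: (@continuous_comp _ _ _ (phase_dot^~ w) k); last exact: ck.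
    exact: continuous_phase_dot.
  by apply: (weight_bounded_le (c := 1) fw) => z; rewrite mul1r normrM ler_piMr.
apply: (@continuous_lipschitz _ (\int[mu]_z `|G z|)) => w w'.
rewrite -RintegralB// mulrC -RintegralZl//.
have iB : mu.-integrable setT (EFin \o (fun z => f z * k (phase_dot z w) -
    f z * k (phase_dot z w'))) by have := integrableB measurableT (ik w) (ik w').
apply: le_trans (le_normr_Rintegral measurableT iB) _.
apply: le_Rintegral => // [| |z _].
- by have := integrable_abse iB.
- exact: (integrableZl measurableT _ iGa).
rewrite -mulrBr normrM /G normrM [leRHS]mulrCA ler_wpM2l//.
apply: le_trans (kL _ _) _; apply: le_trans (phase_dotB _ _ _) _.
by rewrite ler_wpM2l// ler_norm.
Qed.

End rapid_decay.

Section fourier.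
Context (R : realType) (d : nat).
Local Notation E := ('rV[R]_d * 'rV[R]_d)%type.
Implicit Types (a : E -> R[i]) (w z : E).

Lemma cvg_complex (T : Type) (F : set_system T) {FF : Filter F} (f g : T -> R) (l m : R) :
  f @ F --> l -> g @ F --> m ->
  ((f t +i* g t)%C : R[i]^o) @[t --> F] --> ((l +i* m)%C : R[i]^o).
Proof.
move=> fl gm; apply/cvg_rnormP.
have fl0 : `|f t - l| @[t --> F] --> (0 : R).
  by rewrite -(normr0 R) -(subrr l); apply: cvg_norm; apply: cvgB => //; exact: cvg_cst.
have gm0 : `|g t - m| @[t --> F] --> (0 : R).
  by rewrite -(normr0 R) -(subrr m); apply: cvg_norm; apply: cvgB => //; exact: cvg_cst.
apply: (@squeeze_cvgr _ _ _ _ (cst 0) (fun t => `|f t - l| + `|g t - m|)).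
- by apply: nearW => t /=; rewrite rnorm_ge0 rnorm_complex; exact: (normc_le (f t - l)).
- exact: cvg_cst.
- by rewrite -(addr0 (0 : R)); exact: cvgD.
Qed.

Lemma complex_realM (c x y : R) : c%:C%C * (x +i* y)%C = (c * x +i* (c * y))%C.
Proof. by apply/eqP; rewrite eq_complex /= !mul0r subr0 addr0 !eqxx. Qed.

Lemma continuous_expi : continuous (@expi R : R -> R[i]^o).
Proof. by move=> t; apply: cvg_complex; [exact: continuous_cos|exact: continuous_sin]. Qed.

Lemma expiD (s t : R) : expi (s + t) = expi s * expi t.
Proof. by rewrite /expi cosD sinD [sin s * cos t + _]addrC. Qed.

Lemma expi0 : expi (0 : R) = 1.
Proof. by rewrite /expi cos0 sin0. Qed.

Lemma fourierE a w : schwartz a -> fourier a w =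
  ((pi *+ 2) ^- d)%:C%C *
   ((cos_transform (fun z => complex.Re (a z)) w + sin_transform (fun z => complex.Im (a z)) w) +i*
    (cos_transform (fun z => complex.Im (a z)) w - sin_transform (fun z => complex.Re (a z)) w))%C.
Proof.
move=> [sr si]; rewrite /fourier /complex_integral; congr (_ * (_ +i* _)%C).
- have cr := real_schwartz_continuous sr; have ci := real_schwartz_continuous si.
  have rw := rapid_weight_bounded (real_schwartz_rapid [::] sr).
  have iw := rapid_weight_bounded (real_schwartz_rapid [::] si).
  rewrite -RintegralD//; [|exact: integrable_mul_cos|exact: integrable_mul_sin].
  apply: eq_Rintegral => z _; rewrite /expi -/(phase_dot z w) cosN sinN.
  by case: (a z) => x y /=; rewrite mulrN opprK.
- have cr := real_schwartz_continuous sr; have ci := real_schwartz_continuous si.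
  have rw := rapid_weight_bounded (real_schwartz_rapid [::] sr).
  have iw := rapid_weight_bounded (real_schwartz_rapid [::] si).
  rewrite -RintegralB//; [|exact: integrable_mul_cos|exact: integrable_mul_sin].
  apply: eq_Rintegral => z _; rewrite /expi -/(phase_dot z w) cosN sinN.
  by case: (a z) => x y /=; rewrite mulrN addrC.
Qed.

(** This is the form in which the decay of the Fourier transform is used: Weyl operators being
    uniformly bounded, it makes the integrals of the calculus and of the truncated twisted
    convolution converge absolutely. *)
Lemma normc_fourier_le a : schwartz a ->
  exists M : R, forall w, normc (fourier a w) <= M * phase_weight w.
Proof.
move=> sa; have [sr si] := sa.
have [/rapid_weight_bounded rc /rapid_weight_bounded rs] := rapid_transform sr.
have [/rapid_weight_bounded ic /rapid_weight_bounded is_] := rapid_transform si.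
have [M1 H1] := weight_boundedD rc is_.
have [M2 H2] : weight_bounded (fun w => cos_transform (fun z => complex.Im (a z)) w -
    sin_transform (fun z => complex.Re (a z)) w).
  apply: weight_boundedD => //; apply: (weight_bounded_le (c := 1) rs) => w.
  by rewrite mul1r normrN.
exists (`|(pi *+ 2) ^- d| * (M1 + M2)) => w; rewrite fourierE// normcZ -mulrA.
rewrite ler_wpM2l// (le_trans (normc_le _ _))// mulrDl.
by apply: lerD; [exact: H1|exact: H2].
Qed.

Lemma continuous_fourier a : schwartz a -> continuous (fourier a : E -> R[i]^o).
Proof.
move=> sa w0; have [sr si] := sa.
have Hc (f : E -> R) : real_schwartz f -> continuous (cos_transform f).
  move=> sf; exact: (@transform_lipschitz _ _ f (@cos R) sf (@continuous_cos R)
    (@cos_max R) (@ler_dist_cos R)).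
have Hs (f : E -> R) : real_schwartz f -> continuous (sin_transform f).
  move=> sf; exact: (@transform_lipschitz _ _ f (@sin R) sf (@continuous_sin R)
    (@sin_max R) (@ler_dist_sin R)).
pose u w := (pi *+ 2) ^- d *
  (cos_transform (fun z => complex.Re (a z)) w + sin_transform (fun z => complex.Im (a z)) w).
pose v w := (pi *+ 2) ^- d *
  (cos_transform (fun z => complex.Im (a z)) w - sin_transform (fun z => complex.Re (a z)) w).
have -> : fourier a = fun w => (u w +i* v w)%C.
  by apply/funext => w'; rewrite fourierE// complex_realM.
apply: cvg_complex; apply: cvgMr.
  by apply: cvgD; [exact: Hc|exact: Hs].
by apply: cvgB; [exact: Hc|exact: Hs].
Qed.

End fourier.

(** * Products of commuting groups: bounds, strong continuity, group law *)

Section exp_tuple.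
Context (R : realType) (X : normedModType R[i]).

(** Strong convergence of uniformly bounded operators allows the argument to move as well: S_t h_t -
    S_0 h_0 = S_t (h_t - h_0) + (S_t h_0 - S_0 h_0). *)
Lemma cvg_strong (T : Type) (F : set_system T) {FF : Filter F} (S : T -> X -> X)
    (S0 : X -> X) (h : T -> X) (h0 : X) (M : R) :
  (forall t, linear (S t)) -> (forall t x, rnorm (S t x) <= M * rnorm x) ->
  S t h0 @[t --> F] --> S0 h0 -> h @ F --> h0 ->
  S t (h t) @[t --> F] --> S0 h0.
Proof.
move=> linS boundS /cvg_rnormP Sh /cvg_rnormP hh; apply/cvg_rnormP.
apply: (@squeeze_cvgr _ _ _ _ (cst 0)
  (fun t => M * rnorm (h t - h0) + rnorm (S t h0 - S0 h0))).
- apply: nearW => t /=; rewrite rnorm_ge0 /=.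
  have -> : S t (h t) - S0 h0 = S t (h t - h0) + (S t h0 - S0 h0).
    have := linS t 1 (h t - h0) h0; rewrite !scale1r subrK => ->.
    by rewrite addrA.
  by rewrite (le_trans (ler_rnormD _ _))// lerD2r.
- exact: cvg_cst.
- rewrite [X in _ --> X](_ : 0 = M * 0 + 0); last by rewrite mulr0 addr0.
  by apply: cvgD => //; exact: cvgMr.
Qed.

Context (d : nat) (A : 'I_d -> unbounded_op X).
Hypothesis A_gen : forall j, group_generator (A j).

Lemma is_exp_group_exp_group j : is_exp_group (A j) (exp_group (A j)).
Proof. by have [_ _ _ [T HT]] := A_gen j; apply: xgetPex; exists T. Qed.

Lemma continuous_exp_group j x : continuous (fun t => exp_group (A j) t x).
Proof.
have [[_ _ _ TD T0] _ _] := is_exp_group_exp_group j.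
move=> t; pose f s := exp_group (A j) s (exp_group (A j) t x).
have fE : (fun t => exp_group (A j) t x) = f \o (fun s => s - t).
  by apply/funext => s; rewrite /f /= -TD subrK.
have : f \o (fun s => s - t) @ t --> exp_group (A j) t x.
  have t0 : s - t @[s --> t] --> t - t by apply: cvgB; [exact: cvg_id|exact: cvg_cst].
  by rewrite subrr in t0; exact: (cvg_comp _ f t0 (T0 (exp_group (A j) t x))).
by rewrite -fE.
Qed.

(** Products over arbitrary lists of indices allow induction on the list; [exp_tuple] is the product
    over the enumeration of all indices. *)
Definition exp_seq (s : seq 'I_d) (u : 'rV[R]_d) : X -> X :=
  \big[(fun S T : X -> X => S \o T)/id]_(j <- s) exp_group (A j) (u ord0 j).

Lemma exp_seq_cons j s u x :
  exp_seq (j :: s) u x = exp_group (A j) (u ord0 j) (exp_seq s u x).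
Proof. by rewrite /exp_seq big_cons. Qed.

Lemma exp_seq_linear s u : linear (exp_seq s u).
Proof.
elim: s => [|j s IH] c x y; first by rewrite /exp_seq big_nil.
have [[lin _ _ _ _] _ _] := is_exp_group_exp_group j.
by rewrite !exp_seq_cons IH lin.
Qed.

Lemma exp_seq_bounded s :
  exists2 M : R, 0 <= M & forall u x, rnorm (exp_seq s u x) <= M * rnorm x.
Proof.
elim: s => [|j s [M M0 IH]].
  by exists 1 => // u x; rewrite /exp_seq big_nil mul1r.
have [_ [K HK] _] := is_exp_group_exp_group j.
exists (`|K| * M); first by rewrite mulr_ge0.
move=> u x; rewrite exp_seq_cons (le_trans (HK _ _))//.
rewrite (le_trans (ler_wpM2r (rnorm_ge0 _) (ler_norm K)))//.
by rewrite -mulrA ler_wpM2l.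
Qed.

Lemma continuous_exp_seq s x : continuous (fun u => exp_seq s u x).
Proof.
elim: s => [|j s IH] u.
  have -> : (fun u => exp_seq [::] u x) = cst x.
    by apply/funext => v; rewrite /exp_seq big_nil.
  exact: cst_continuous.
have -> : (fun u => exp_seq (j :: s) u x) =
    (fun u => exp_group (A j) (u ord0 j) (exp_seq s u x)).
  by apply/funext => v; rewrite exp_seq_cons.
have [[lin _ _ _ _] [K HK] _] := is_exp_group_exp_group j.
rewrite /continuous_at.
apply: (@cvg_strong _ (nbhs u) _ (fun v : 'rV[R]_d => exp_group (A j) (v ord0 j))
  (exp_group (A j) (u ord0 j)) (fun v => exp_seq s v x) _ K).
- by move=> v; exact: lin.
- by move=> v y; exact: HK.
- apply: (@continuous_comp _ _ _ (fun v : 'rV[R]_d => v ord0 j)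
    (fun t => exp_group (A j) t (exp_seq s u x))).
    exact: coord_continuous.
  exact: continuous_exp_group.
- exact: IH.
Qed.

Lemma exp_seq0 s x : exp_seq s 0 x = x.
Proof.
elim: s => [|j s IH]; first by rewrite /exp_seq big_nil.
have [[_ _ T0 _ _] _ _] := is_exp_group_exp_group j.
by rewrite exp_seq_cons mxE T0.
Qed.

Hypothesis A_comm : forall s t j k x, exp_group (A j) s (exp_group (A k) t x) =
  exp_group (A k) t (exp_group (A j) s x).

Lemma exp_group_seq_comm j t s u x :
  exp_group (A j) t (exp_seq s u x) = exp_seq s u (exp_group (A j) t x).
Proof.
elim: s => [|k s IH]; first by rewrite /exp_seq big_nil.
by rewrite !exp_seq_cons A_comm IH.
Qed.

Lemma exp_seqD s u v x : exp_seq s (u + v) x = exp_seq s u (exp_seq s v x).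
Proof.
elim: s => [|j s IH]; first by rewrite /exp_seq !big_nil.
have [[_ _ _ TD _] _ _] := is_exp_group_exp_group j.
by rewrite !exp_seq_cons mxE TD IH exp_group_seq_comm.
Qed.

End exp_tuple.

(** * Weyl operators *)

Section group_bound.
Context (R : realType) (X : normedModType R[i]).

Lemma linear_scale (S : X -> X) (c : R[i]) x : linear S -> S (c *: x) = c *: S x.
Proof.
move=> linS; have S0 : S 0 = 0.
  by have := linS (-1) 0 0; rewrite scaler0 addr0 scaleN1r addNr.
by have := linS c x 0; rewrite !addr0 S0 addr0.
Qed.

Lemma opnorm_ge0 (S : X -> X) :
  (0 <= opnorm (Y := normed_space X) (Z := normed_space X) S)%E.
Proof.
apply: (@le_trans _ _ (rnorm (S 0))%:E); first by rewrite lee_fin rnorm_ge0.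
apply: ereal_sup_ubound; exists 0 => //=; split=> //=.
by rewrite lee_fin rnorm0.
Qed.

Lemma le_opnorm (S : X -> X) x : linear S ->
  ((rnorm (S x))%:E <=
   opnorm (Y := normed_space X) (Z := normed_space X) S * (rnorm x)%:E)%E.
Proof.
move=> linS; have [->|x0] := eqVneq x 0.
  by rewrite -[X in S X](scale0r 0) linear_scale// scale0r rnorm0 mule0.
have nx : 0 < rnorm x by rewrite lt_neqAle eq_sym rnorm_eq0 x0 rnorm_ge0.
rewrite -[X in (X <= _)%E]mule1 -[in leLHS](mulVf (lt0r_neq0 nx)) EFinM muleA.
rewrite lee_pmul2r ?lte_fin// -EFinM.
apply: ereal_sup_ubound; exists (((rnorm x)^-1)%:C%C *: x) => /=.
  by split=> //; rewrite rnormZ normc_real gtr0_norm ?invr_gt0// mulVf// lt0r_neq0.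
by rewrite linear_scale// rnormZ normc_real gtr0_norm ?invr_gt0// mulrC.
Qed.

Context (d : nat) (A : 'I_d -> unbounded_op X).
Hypothesis A_gen : forall j, group_generator (A j).

Lemma exp_tuple_seq u : exp_tuple A u = exp_seq A (index_enum 'I_d) u.
Proof. by []. Qed.

Lemma group_bound_ge0 : (0 <= group_bound A)%E.
Proof.
apply: (le_trans (opnorm_ge0 (exp_tuple A 0))).
by apply: ereal_sup_ubound; exists 0.
Qed.

Lemma group_bound_fin_num : group_bound A \is a fin_num.
Proof.
rewrite ge0_fin_numE ?group_bound_ge0//.
have [M M0 HM] := exp_seq_bounded A_gen (index_enum 'I_d).
apply: (@le_lt_trans _ _ M%:E); last exact: ltry.
apply: ge_ereal_sup => _ [u _ <-]; apply: ge_ereal_sup => _ [x [_ x1] <-] /=.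
rewrite lee_fin (le_trans (HM u x))//.
by rewrite -[leRHS]mulr1 ler_wpM2l// -lee_fin.
Qed.

Lemma rnorm_exp_tuple u x :
  rnorm (exp_tuple A u x) <= fine (group_bound A) * rnorm x.
Proof.
rewrite -lee_fin EFinM fineK ?group_bound_fin_num//.
apply: le_trans (le_opnorm _ (exp_seq_linear A_gen (index_enum 'I_d) u)) _.
rewrite lee_wpmul2r ?lee_fin ?rnorm_ge0//.
by apply: ereal_sup_ubound; exists u.
Qed.

(** At parameter 0 the group is the identity. This makes division by [weyl_bound] legitimate on a
    nonzero space. *)
Lemma group_bound_ge1 (x : X) : x != 0 -> 1 <= fine (group_bound A).
Proof.
move=> x0; have nx : 0 < rnorm x by rewrite lt_neqAle eq_sym rnorm_eq0 x0 rnorm_ge0.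
have := rnorm_exp_tuple 0 x; rewrite exp_tuple_seq exp_seq0//.
by rewrite -{1}(mul1r (rnorm x)) ler_pM2r.
Qed.

End group_bound.

Section weyl_pair.
Context (R : realType) (X : normedModType R[i]) (d : nat).
Context (A B : 'I_d -> unbounded_op X).
Hypothesis AB : weyl_pair A B.
Local Notation E := ('rV[R]_d * 'rV[R]_d)%type.
Implicit Types (u v : 'rV[R]_d) (w z : E) (x : X).

Let A_gen : forall j, group_generator (A j). Proof. by case: AB. Qed.
Let B_gen : forall j, group_generator (B j). Proof. by case: AB. Qed.

Lemma weyl_exp_group_seq j t s v x :
  exp_group (A j) t (exp_seq B s v x) =
  expi (- (t * \sum_(k <- s) v ord0 k * (j == k)%:R)) *:
    exp_seq B s v (exp_group (A j) t x).
Proof.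
have [_ _ _ _ weyl] := AB.
elim: s => [|k s IH].
  by rewrite /exp_seq !big_nil mulr0 oppr0 expi0 scale1r.
have [[linB _ _ _ _] _ _] := is_exp_group_exp_group B_gen k.
rewrite !exp_seq_cons weyl IH linear_scale// scalerA -expiD; congr (expi _ *: _).
by rewrite big_cons; ring.
Qed.

Lemma weyl_exp_seq s u s' v x :
  exp_seq A s u (exp_seq B s' v x) =
  expi (- \sum_(j <- s) u ord0 j * \sum_(k <- s') v ord0 k * (j == k)%:R) *:
    exp_seq B s' v (exp_seq A s u x).
Proof.
elim: s => [|j s IH].
  by rewrite /exp_seq !big_nil oppr0 expi0 scale1r.
have [[linA _ _ _ _] _ _] := is_exp_group_exp_group A_gen j.
rewrite !exp_seq_cons IH linear_scale// weyl_exp_group_seq scalerA -expiD.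
by congr (expi _ *: _); rewrite big_cons; ring.
Qed.

Lemma weyl_exp_tuple u v x : exp_tuple A u (exp_tuple B v x) =
  expi (- dotp u v) *: exp_tuple B v (exp_tuple A u x).
Proof.
rewrite !exp_tuple_seq weyl_exp_seq; congr (expi (- _) *: _).
apply: eq_bigr => j _; congr (_ * _); rewrite (bigD1 j)//= eqxx mulr1.
by rewrite big1 ?addr0// => k kj; rewrite eq_sym (negbTE kj) mulr0.
Qed.

Lemma exp_tuple_weyl u v x : exp_tuple B v (exp_tuple A u x) =
  expi (dotp u v) *: exp_tuple A u (exp_tuple B v x).
Proof. by rewrite weyl_exp_tuple scalerA -expiD subrr expi0 scale1r. Qed.

Local Notation W := (exp_weyl A B).

Lemma exp_weyl_linear w : linear (W w).
Proof.
move=> c x y; rewrite /exp_weyl !exp_tuple_seq (exp_seq_linear B_gen).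
by rewrite (exp_seq_linear A_gen) scalerDr !scalerA mulrC.
Qed.

Definition weyl_bound := fine (group_bound A) * fine (group_bound B).

Lemma weyl_bound_ge0 : 0 <= weyl_bound.
Proof. by rewrite mulr_ge0 ?fine_ge0 ?group_bound_ge0. Qed.

Lemma rnorm_exp_weyl w x : rnorm (W w x) <= weyl_bound * rnorm x.
Proof.
rewrite /exp_weyl rnormZ normc_expi mul1r.
rewrite (le_trans (rnorm_exp_tuple A_gen _ _))// -mulrA ler_wpM2l//.
  by rewrite fine_ge0 ?group_bound_ge0.
exact: rnorm_exp_tuple.
Qed.

Lemma continuous_dotp_phase : continuous (fun w : E => dotp w.1 w.2).
Proof.
move=> w; rewrite /dotp; apply: cvg_big => [|j _]; first exact: add_continuous.
by apply: cvgM; [exact: (@continuous_phase_coord _ _ (inl j))|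
  exact: (@continuous_phase_coord _ _ (inr j))].
Qed.

Lemma cvg_scale_expi (T : Type) (F : set_system T) {FF : Filter F} (f : T -> R) (l : R)
    (g : T -> X) y : f @ F --> l -> g @ F --> y -> expi (f t) *: g t @[t --> F] --> expi l *: y.
Proof.
move=> fl; apply: (@cvg_strong _ _ T F _ (fun t x => expi (f t) *: x)
  (fun x => expi l *: x) g y 1).
- by move=> t c u v; rewrite scalerDr !scalerA mulrC.
- by move=> t u; rewrite rnormZ normc_expi.
- have := cvg_comp f (@expi R : R -> R[i]^o) fl (@continuous_expi R l).
  move=> /cvg_rnormP el; apply/cvg_rnormP.
  rewrite [X in _ --> X](_ : 0 = 0 * rnorm y); last by rewrite mul0r.
  under eq_cvg do rewrite -scalerBl rnormZ -rnorm_complex.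
  exact: cvgMl.
Qed.

Lemma continuous_exp_weyl x : continuous (fun w => W w x).
Proof.
move=> w; apply: cvg_scale_expi.
  by apply: cvgMl; exact: continuous_dotp_phase.
have [M _ HM] := exp_seq_bounded A_gen (index_enum 'I_d).
apply: (@cvg_strong _ _ _ (nbhs w) _ (fun w : E => exp_tuple A w.1) (exp_tuple A w.1)
  (fun w => exp_tuple B w.2 x) _ M).
- by move=> v; exact: (exp_seq_linear A_gen).
- by move=> v y; exact: HM.
- apply: (@continuous_comp _ _ _ fst (fun u => exp_tuple A u (exp_tuple B w.2 x))).
    exact: cvg_fst.
  exact: (continuous_exp_seq A_gen).
- apply: (@continuous_comp _ _ _ snd (fun v => exp_tuple B v x)).
    exact: cvg_snd.
  exact: (continuous_exp_seq B_gen).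
Qed.

Lemma exp_weyl0 x : W 0 x = x.
Proof.
by rewrite /exp_weyl !exp_tuple_seq !exp_seq0//= dotp0 mul0r expi0 scale1r.
Qed.

Lemma dotpDr n (u v v' : 'rV[R]_n) : dotp u (v + v') = dotp u v + dotp u v'.
Proof. by rewrite dotpC dotpDl !(dotpC _ u). Qed.

(** For w = (u,v) and w' = (u',v'), moving e^(ivB) past e^(iu'A) costs the phase u'v. The
    symmetrizing factors e^(iuv/2) of the three Weyl operators turn it into half the symplectic
    form, (u'v - uv')/2. *)
Lemma exp_weylM w w' x :
  W w (W w' x) = expi ((dotp w'.1 w.2 - dotp w.1 w'.2) / 2) *: W (w + w') x.
Proof.
have [_ _ commA commB _] := AB.
have EA_lin u : linear (exp_tuple A u) := exp_seq_linear A_gen (index_enum 'I_d) u.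
have EB_lin u : linear (exp_tuple B u) := exp_seq_linear B_gen (index_enum 'I_d) u.
have EAD u v y : exp_tuple A (u + v) y = exp_tuple A u (exp_tuple A v y).
  by rewrite !exp_tuple_seq exp_seqD.
have EBD u v y : exp_tuple B (u + v) y = exp_tuple B u (exp_tuple B v y).
  by rewrite !exp_tuple_seq exp_seqD.
rewrite /exp_weyl /= EAD EBD (linear_scale _ _ (EB_lin _)) (linear_scale _ _ (EA_lin _)).
rewrite exp_tuple_weyl (linear_scale _ _ (EA_lin _)) !scalerA -!expiD.
congr (expi _ *: _); by rewrite dotpDl !dotpDr; field.
Qed.

Lemma dotpNl n (u v : 'rV[R]_n) : dotp (- u) v = - dotp u v.
Proof. by rewrite -scaleN1r dotpZl mulN1r. Qed.

Lemma dotpNr n (u v : 'rV[R]_n) : dotp u (- v) = - dotp u v.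
Proof. by rewrite dotpC dotpNl dotpC. Qed.

Lemma exp_weylNM z w x :
  W (- z) (W w x) = expi ((dotp z.1 w.2 - dotp w.1 z.2) / 2) *: W (w - z) x.
Proof.
by rewrite exp_weylM /= dotpNl dotpNr opprK [- z + w]addrC [- _ + _]addrC.
Qed.

Lemma exp_weylK z x : W z (W (- z) x) = x.
Proof.
by rewrite exp_weylM /= dotpNl dotpNr subrr mul0r expi0 scale1r subrr exp_weyl0.
Qed.

End weyl_pair.

(** * Transference *)

Section transference.
Context (R : realType) (X : completeNormedModType R[i]) (d : nat).
Context (A B : 'I_d -> unbounded_op X).
Hypothesis AB : weyl_pair A B.
Local Notation E := ('rV[R]_d * 'rV[R]_d)%type.
Local Notation mu := (@lebesgue_phase R d).
Local Notation W := (exp_weyl A B).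
Local Notation M := (weyl_bound A B).
Implicit Types (a : E -> R[i]) (w z : E) (x : X).

Definition cutoff_orbit (r : R) x z : X := if z \in phase_box r then W (- z) x else 0.

Lemma measurable_phase_reflect z : measurable_fun setT (fun w : E => z - w).
Proof.
apply: measurable_fun_pair; apply: measurable_fun_rV => i /=.
  under eq_fun do rewrite !mxE; apply: measurable_funB => //.
  exact: (measurableT_comp (measurable_rV_coord i) measurable_fst).
under eq_fun do rewrite !mxE; apply: measurable_funB => //.
exact: (measurableT_comp (measurable_rV_coord i) measurable_snd).
Qed.

Lemma measurable_reflect_box z r : measurable [set w : E | phase_box r (z - w)].
Proof.
rewrite -[X in measurable X]setTI.
exact: (@measurable_phase_reflect z measurableT _ (measurable_phase_box (d := d) r)).
Qed.

Definition twist z w : R := (dotp z.1 w.2 - dotp w.1 z.2) / 2.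

Lemma continuous_twist z : continuous (twist z).
Proof.
have dE : twist z = fun w => (\sum_(j < d) z.1 ord0 j * w.2 ord0 j -
  \sum_(j < d) w.1 ord0 j * z.2 ord0 j) / 2 by [].
move=> w; rewrite dE; apply: cvgMl.
apply: cvgB; apply: cvg_big => [|j _]; try exact: add_continuous.
  by apply: cvgMr; exact: (@continuous_phase_coord _ _ (inr j)).
by apply: cvgMl; exact: (@continuous_phase_coord _ _ (inl j)).
Qed.

Lemma continuous_fourier_scale a (f : E -> X) : schwartz a -> continuous f ->
  continuous (fun w => fourier a w *: f w).
Proof. by move=> sa cf w; apply: cvgZ; [exact: (continuous_fourier sa)|exact: cf]. Qed.

Lemma continuous_twisted_integrand a z x : schwartz a ->
  continuous (fun w => (expi (twist z w) * fourier a w) *: W (w - z) x).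
Proof.
move=> sa w; have H : expi (twist z w') *: (fourier a w' *: W (w' - z) x)
    @[w' --> w] --> expi (twist z w) *: (fourier a w *: W (w - z) x).
  apply: cvg_scale_expi; first exact: continuous_twist.
  apply: (@continuous_fourier_scale a (fun w => W (w - z) x) sa _ w) => {}w.
  apply: (@continuous_comp _ _ _ (fun w => w - z) (fun w => W w x)).
    by apply: cvgB; [exact: cvg_id|exact: cvg_cst].
  exact: continuous_exp_weyl.
rewrite scalerA in H; apply: cvg_trans H; apply: near_eq_cvg; apply: nearW => w'.
by rewrite scalerA.
Qed.

Lemma L1_norm_weight_lty (f : E -> X) (C : R) :
  (forall w, rnorm (f w) <= C * phase_weight w) -> (L1_norm mu f < +oo)%E.
Proof.
move=> fC; apply: (@le_lt_trans _ _ (\int[mu]_w `|(C * phase_weight w)%:E|)%E).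
  apply: ge0_integral_mono => w; first by rewrite lee_fin rnorm_ge0.
  by rewrite lee_fin (le_trans (fC w))// ler_norm.
by have /integrableP[] := integrableZl measurableT C (integrable_phase_weight R d).
Qed.

Definition weight_tail (m : nat) : R :=
  \int[mu]_w (phase_weight w * \1_(~` phase_box m%:R) w).

Lemma measurable_tail (m : nat) :
  measurable_fun setT (fun w : E => phase_weight w * \1_(~` phase_box m%:R) w).
Proof.
apply: measurable_funM; first exact: measurable_phase_weight.
by apply: measurable_indic; apply: measurableC; exact: measurable_phase_box.
Qed.

Lemma tail_le (m : nat) w :
  `|phase_weight w * \1_(~` phase_box m%:R) w| <= phase_weight w :> R.
Proof.
have w0 := ltW (phase_weight_gt0 w).
by rewrite indicE; case: (_ \in _); rewrite ?mulr1 ?mulr0 ?normr0// ger0_norm.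
Qed.

Lemma integrable_tail (m : nat) : mu.-integrable setT
  (EFin \o (fun w => phase_weight w * \1_(~` phase_box m%:R) w)).
Proof.
apply: integrable_weight_bounded; first exact: measurable_tail.
by exists 1 => w; rewrite mul1r; exact: tail_le.
Qed.

Lemma weight_tail_cvg0 : weight_tail m @[m --> \oo] --> (0 : R).
Proof.
have : (\int[mu]_w (phase_weight w * \1_(~` phase_box m%:R) w)%:E)%E @[m --> \oo]
    --> (\int[mu]_w cst 0 w)%E.
  apply: (@dominated_cvg _ _ _ mu setT measurableT
    (fun m w => (phase_weight w * \1_(~` phase_box m%:R) w)%:E) (cst 0%E)
    (EFin \o @phase_weight R d)) => //.
  - by move=> m; apply/measurable_EFinP; exact: measurable_tail.
  - move=> w _; apply: cvg_near_cst; have := near_phase_box w; apply: filterS => m wm.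
    by rewrite indicE memNset ?mulr0//= => /(_ wm).
  - exact: integrable_phase_weight.
  - by move=> m w _; rewrite lee_fin tail_le.
by rewrite integral0 => /fine_cvgP[].
Qed.

Lemma weight_tail_ge0 m : 0 <= weight_tail m.
Proof.
by apply: Rintegral_ge0 => w _; rewrite mulr_ge0// ltW// phase_weight_gt0.
Qed.

Lemma transference_error a : schwartz a -> exists e : R^nat,
  [/\ forall m, 0 <= e m, e @ \oo --> (0 : R) &
  forall x (n : R) (m : nat) z, phase_box n z ->
    rnorm (W (- z) (weyl_calculus A B a x) -
      twisted_convolution (fourier a) (cutoff_orbit (n + m%:R) x) z) <= e m * rnorm x].
Proof.
move=> sa; have [Ma HMa] := normc_fourier_le sa.
set c0 : R := (pi *+ 2) ^- d.
(* The factors are the normalization (2 pi)^-d, the constant in the decay of the Fourier transform,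
   the bound of the Weyl operators, and the mass of the weight outside the box of radius [m]. *)
exists (fun m => `|c0| * (`|Ma| * M * weight_tail m)); split.
- move=> m; apply: mulr_ge0 => //; apply: mulr_ge0 (weight_tail_ge0 m).
  exact: mulr_ge0 (weyl_bound_ge0 A B).
- rewrite [X in _ --> X](_ : 0 = `|c0| * (`|Ma| * M * 0)); last by rewrite !mulr0.
  by apply: cvgMr; apply: cvgMr; exact: weight_tail_cvg0.
move=> x n m z zn; set r := n + m%:R.
pose f w := fourier a w *: W w x.
pose F w := (expi (twist z w) * fourier a w) *: W (w - z) x.
pose S := [set w : E | phase_box r (z - w)].
pose G w := if w \in S then F w else 0.
have fP : simple_limit mu f.
  by apply/simple_limit_continuous/continuous_fourier_scale => //; exact: continuous_exp_weyl.
have FP : simple_limit mu F.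
  by apply/simple_limit_continuous; exact: continuous_twisted_integrand.
have GP : simple_limit mu G.
  by apply: simple_limit_restrict => //; exact: measurable_reflect_box.
have MaM w : normc (fourier a w) <= `|Ma| * phase_weight w.
  by rewrite (le_trans (HMa w))// ler_wpM2r ?ler_norm// ltW// phase_weight_gt0.
have fM w w' y : normc (fourier a w) * rnorm (W w' y) <= `|Ma| * M * rnorm y * phase_weight w.
  rewrite (_ : _ * phase_weight w = (`|Ma| * phase_weight w) * (M * rnorm y)); last by ring.
  by apply: ler_pM; [exact: normc_ge0|exact: rnorm_ge0|exact: MaM|exact: rnorm_exp_weyl].
have FM w : rnorm (F w) <= `|Ma| * M * rnorm x * phase_weight w.
  by rewrite rnormZ ComplexField.Normc.normcM normc_expi mul1r.
have GM w : rnorm (G w) <= `|Ma| * M * rnorm x * phase_weight w.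
  rewrite /G; case: ifP => // _; rewrite rnorm0 mulr_ge0 ?rnorm_ge0//.
    by rewrite mulr_ge0 ?rnorm_ge0// mulr_ge0//; exact: weyl_bound_ge0.
  exact/ltW/phase_weight_gt0.
have IF := bochner_integrableP FP (L1_norm_weight_lty FM).
have IG := bochner_integrableP GP (L1_norm_weight_lty GM).
have fM' w : rnorm (f w) <= `|Ma| * M * rnorm x * phase_weight w by rewrite rnormZ.
have If := bochner_integrableP fP (L1_norm_weight_lty fM').
(* The operator W(-z) is bounded and linear, so it passes under the integral, where [exp_weylNM]
   produces the twist. *)
have WF : W (- z) (weyl_calculus A B a x) = c0%:C%C *: bochner_integral mu F.
  rewrite /weyl_calculus (linear_scale _ _ (exp_weyl_linear AB _)); congr (_ *: _).
  apply/esym/bochner_integralE => //.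
  have := is_bochner_integral_map (exp_weyl_linear AB (- z))
    (rnorm_exp_weyl AB (- z)) fP If.
  congr is_bochner_integral; apply/funext => w; rewrite /f /F /=.
  rewrite (linear_scale _ _ (exp_weyl_linear AB _)) exp_weylNM// scalerA mulrC.
  by [].
have TG : twisted_convolution (fourier a) (cutoff_orbit r x) z =
    c0%:C%C *: bochner_integral mu G.
  rewrite /twisted_convolution; congr (_ *: bochner_integral _ _).
  apply/funext => w; rewrite /G /cutoff_orbit -/(twist z w).
  have -> : (w \in S) = (z - w \in phase_box r) by apply/idP/idP; rewrite !inE.
  by case: ifP => // _; rewrite ?scaler0// opprB.
rewrite WF TG -scalerBr rnormZ normc_real -[leRHS]mulrA ler_wpM2l// [leRHS]mulrAC.
(* The error is the integral of F - G. It vanishes for [w] in the box of radius [m], since [z - w]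
   then lies in the box of radius r = n + m; elsewhere the bound [FM] on [F] leaves the tail of the
   weight. *)
have := is_bochner_integral_norm _ (is_bochner_integral_linear (-1) GP FP IG IF).
rewrite scaleN1r [- _ + _]addrC => /(_ (simple_limit_linear (-1) GP FP)) H.
rewrite -lee_fin; apply: le_trans H _.
rewrite /weight_tail -RintegralZl//; last exact: integrable_tail.
have it := integrableZl measurableT (`|Ma| * M * rnorm x) (integrable_tail m).
rewrite /Rintegral fineK; last exact: integrable_fin_num it.
apply: ge0_integral_mono => w; first by rewrite lee_fin rnorm_ge0.
have C0 : 0 <= `|Ma| * M * rnorm x.
  by apply: mulr_ge0 (rnorm_ge0 x); apply: mulr_ge0 => //; exact: weyl_bound_ge0.
rewrite lee_fin /G; case: ifPn => [_|wS].
  rewrite scaleN1r addrC subrr rnorm0; apply: mulr_ge0 => //.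
  by apply: mulr_ge0 => //; exact/ltW/phase_weight_gt0.
rewrite scaler0 add0r indicE mem_set ?mulr1//= => wm.
by move: wS; rewrite notin_setE; apply; exact: phase_boxB.
Qed.

End transference.

(** * Comparison of L^p norms on boxes *)

Section transference_Lp.
Context (R : realType) (X : completeNormedModType R[i]) (d : nat).
Context (A B : 'I_d -> unbounded_op X).
Hypothesis AB : weyl_pair A B.
Context (p : R).
Hypothesis p_ge1 : 1 <= p.
Local Notation E := ('rV[R]_d * 'rV[R]_d)%type.
Local Notation mu := (@lebesgue_phase R d).
Local Notation W := (exp_weyl A B).
Local Notation M := (weyl_bound A B).
Local Notation orbit := (cutoff_orbit A B).
Implicit Types (a : E -> R[i]) (w z : E) (x : X).

Let p_gt0 : 0 < p. Proof. exact: lt_le_trans p_ge1. Qed.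
Let p_neq0 : p != 0. Proof. exact: lt0r_neq0. Qed.

Definition box_Lp_norm (r : R) : R := ((r *+ 2) ^+ (d + d)) `^ p^-1.

Lemma Lp_normE (h : E -> X) :
  Lp_norm mu p h = ((\int[mu]_z ((rnorm (h z)) `^ p)%:E) `^ p^-1)%E.
Proof.
rewrite /Lp_norm unlock; congr (_ `^ _)%E; apply: eq_integral => z _.
by rewrite gee0_abs ?lee_fin ?rnorm_ge0// poweR_EFin.
Qed.

Lemma integral_box_powR (c r : R) : 0 <= c -> 0 <= r ->
  ((\int[mu]_z (c `^ p * \1_(phase_box r) z)%:E) `^ p^-1)%E = (c * box_Lp_norm r)%:E.
Proof.
move=> c0 r0; under eq_integral do rewrite EFinM.
rewrite ge0_integralZl_EFin ?powR_ge0//; last first.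
  by apply/measurable_EFinP/measurable_indic; exact: measurable_phase_box.
rewrite integral_indic//; last exact: measurable_phase_box.
transitivity (((c `^ p)%:E * @lebesgue_phase R d (phase_box r)) `^ p^-1)%E.
  by rewrite setIT.
rewrite lebesgue_phase_box// -EFinM poweR_EFin powRM ?powR_ge0//; last first.
  by rewrite exprn_ge0// mulrn_wge0.
by rewrite -powRrM mulfV// powRr1.
Qed.

Lemma Lp_norm_ge (h : E -> X) (c r : R) : 0 <= c -> 0 <= r ->
  (forall z, phase_box r z -> c <= rnorm (h z)) ->
  ((c * box_Lp_norm r)%:E <= Lp_norm mu p h)%E.
Proof.
move=> c0 r0 ch; rewrite -integral_box_powR// Lp_normE.
have pos z : (0 <= (c `^ p * \1_(phase_box r) z)%:E)%E.
  by rewrite lee_fin mulr_ge0// powR_ge0.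
apply: gt0_ler_poweR.
- by rewrite invr_ge0 ltW.
- by rewrite in_itv/= leey andbT integral_ge0.
- by rewrite in_itv/= leey andbT integral_ge0// => z _; rewrite lee_fin powR_ge0.
apply: ge0_integral_mono => // z; rewrite lee_fin indicE.
have [/[!inE] zr|_] := boolP (z \in phase_box r); last by rewrite mulr0 powR_ge0.
by rewrite mulr1 ge0_ler_powR ?nnegrE ?rnorm_ge0// ?ch// ltW.
Qed.

Lemma Lp_norm_le (h : E -> X) (c r : R) : 0 <= c -> 0 <= r ->
  (forall z, phase_box r z -> rnorm (h z) <= c) ->
  (forall z, ~ phase_box r z -> h z = 0) ->
  (Lp_norm mu p h <= (c * box_Lp_norm r)%:E)%E.
Proof.
move=> c0 r0 hc h0; rewrite -integral_box_powR// Lp_normE.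
have pos z : (0 <= (c `^ p * \1_(phase_box r) z)%:E)%E.
  by rewrite lee_fin mulr_ge0// powR_ge0.
apply: gt0_ler_poweR.
- by rewrite invr_ge0 ltW.
- by rewrite in_itv/= leey andbT integral_ge0// => z _; rewrite lee_fin powR_ge0.
- by rewrite in_itv/= leey andbT integral_ge0.
apply: ge0_integral_mono => // z; rewrite lee_fin ?powR_ge0// indicE.
have [/[!inE] zr|] := boolP (z \in phase_box r).
  by rewrite mulr1 ge0_ler_powR ?nnegrE ?rnorm_ge0// ?hc// ltW.
by rewrite notin_setE => zr; rewrite mulr0 h0// rnorm0 powR0.
Qed.

Lemma exp_weyl_sum (N : nat) (c : 'I_N -> R[i]) (y : 'I_N -> X) z :
  W z (\sum_(i < N) c i *: y i) = \sum_(i < N) c i *: W z (y i).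
Proof.
pose mW := GRing.isLinear.Build R[i] X X *:%R (W z) (exp_weyl_linear AB z).
pose Wl : {linear X -> X} := HB.pack (W z) mW.
rewrite -[W z]/(Wl : X -> X) linear_sum; apply: eq_bigr => i _.
by rewrite linearZ.
Qed.

Lemma cutoff_orbit_Lp_fun r x : 0 <= r -> Lp_fun mu p (orbit r x).
Proof.
move=> r0; split.
  apply: simple_limit_strongly_measurable; apply: simple_limit_restrict.
    exact: measurable_phase_box.
  apply: simple_limit_continuous => z.
  apply: (@continuous_comp _ _ _ (fun z : E => - z) (fun w => W w x)).
    by apply: cvgN; exact: cvg_id.
  exact: continuous_exp_weyl.
have c0 : 0 <= M * rnorm x by rewrite mulr_ge0 ?weyl_bound_ge0 ?rnorm_ge0.
apply: le_lt_trans (ltry (M * rnorm x * box_Lp_norm r)).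
apply: Lp_norm_le => // z zr; rewrite /cutoff_orbit.
  by rewrite mem_set// rnorm_exp_weyl.
by rewrite memNset.
Qed.

Lemma Lp_norm_orbit_sum_le (N : nat) (c : 'I_N -> R[i]) (x : 'I_N -> X) (r : R) :
  0 <= r ->
  (Lp_norm mu p (\sum_(i < N) c i *: (orbit r (x i) : E -> X))%R <=
   (M * rnorm (\sum_(i < N) c i *: x i) * box_Lp_norm r)%R%:E)%E.
Proof.
move=> r0; apply: Lp_norm_le => // [|z zr|z zr].
- by rewrite mulr_ge0 ?weyl_bound_ge0 ?rnorm_ge0.
- rewrite fct_sumE (_ : \sum_(i < N) _ = W (- z) (\sum_(i < N) c i *: x i)).
    exact: rnorm_exp_weyl.
  rewrite exp_weyl_sum; apply: eq_bigr => i _.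
  by transitivity (c i *: orbit r (x i) z); rewrite // /cutoff_orbit mem_set.
- rewrite fct_sumE big1// => i _.
  by transitivity (c i *: orbit r (x i) z); rewrite // /cutoff_orbit memNset// scaler0.
Qed.

(** The errors are chosen before the coefficients [c], so they do not depend on the random parameter
    once [c] is a sample of the random variables. The maximum with 0 makes the bound a nonnegative
    constant, as [Lp_norm_ge] and the later powers require. *)
Lemma Lp_norm_twisted_sum_ge (N : nat) (a : 'I_N -> E -> R[i]) :
  (forall i, schwartz (a i)) -> 0 < M ->
  exists e : 'I_N -> R^nat,
    [/\ forall i m, 0 <= e i m, forall i, e i @ \oo --> (0 : R) &
    forall (c : 'I_N -> R[i]) (x : 'I_N -> X) (n : R) (m : nat), 0 <= n ->
      ((Num.max 0 (rnorm (\sum_(i < N) c i *: weyl_calculus A B (a i) (x i)) / M -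
          \sum_(i < N) normc (c i) * (e i m * rnorm (x i))) * box_Lp_norm n)%R%:E <=
       Lp_norm mu p (\sum_(i < N) c i *:
         (twisted_convolution (fourier (a i)) (orbit (n + m%:R) (x i)) : E -> X))%R)%E].
Proof.
move=> sa M0; have /choice[e eP] : forall i, exists e : R^nat, [/\ forall m, 0 <= e m,
    e @ \oo --> (0 : R) & forall x (n : R) (m : nat) z, phase_box n z ->
    rnorm (W (- z) (weyl_calculus A B (a i) x) -
      twisted_convolution (fourier (a i)) (orbit (n + m%:R) x) z) <= e m * rnorm x].
  by move=> i; exact: transference_error.
exists e; split=> [i|i|c x n m n0]; [by have [] := eP i|by have [] := eP i|].
apply: Lp_norm_ge => // [|z zn]; first by rewrite le_max lexx.
rewrite ge_max rnorm_ge0/= lerBlDr ler_pdivrMr// [leRHS]mulrC.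
set S := \sum_(i < N) c i *: weyl_calculus _ _ _ _.
(* Writing S = W(z) W(-z) S bounds the norm of [S] by [M] times that of W(-z) S, which the twisted
   convolutions approximate at [z]. *)
rewrite -[S in leLHS](exp_weylK AB z) (le_trans (rnorm_exp_weyl AB _ _))// ler_wpM2l ?(ltW M0)//.
rewrite fct_sumE -lerBlDl (le_trans (le_trans (ler_norm _) (ler_dist_rnorm _ _)))//.
rewrite exp_weyl_sum -sumrB (le_trans (ler_rnorm_sum _ _ _))//.
apply: ler_sum => i _; rewrite -scalerBr rnormZ ler_wpM2l ?normc_ge0//.
by have [_ _] := eP i; apply.
Qed.

End transference_Lp.

Lemma cvg_powR (R : realType) (q : R) (u : R^nat) (l : R) : 0 < q ->
  (forall n, 0 <= u n) -> u @ \oo --> l -> u n `^ q @[n --> \oo] --> l `^ q.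
Proof.
move=> q0 u0 ul; have : 0 <= l.
  by rewrite -(cvg_lim _ ul)//; apply: limr_ge; [exact: cvgP ul|exact: nearW].
(* The power is given by the logarithm only away from 0, so the limit 0 is treated by
   monotonicity. *)
rewrite le_eqVlt => /predU1P[l0|l0].
  rewrite -l0 powR0 ?lt0r_neq0//; apply/cvgrPdist_lt => e e0.
  have eq0 : 0 < e `^ q^-1 by exact: powR_gt0.
  have /cvgrPdist_lt/(_ _ eq0) := ul; apply: filterS => n.
  rewrite -l0 !sub0r !normrN !ger0_norm ?powR_ge0//.
  move=> /(gt0_ltr_powR q0); rewrite !nnegrE u0 powR_ge0 -powRrM => /(_ isT isT).
  by rewrite mulVf ?lt0r_neq0// powRr1// ltW.
rewrite /powR (negbTE (lt0r_neq0 l0)).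
have H : expR (q * ln (u n)) @[n --> \oo] --> expR (q * ln l).
  have qln : q * ln (u n) @[n --> \oo] --> q * ln l.
    by apply: cvgMr; exact: (cvg_comp _ _ ul (continuous_ln l0)).
  exact: (cvg_comp _ _ qln (@continuous_expR R _)).
apply: cvg_trans H; apply: near_eq_cvg.
have /cvgrPdist_lt/(_ _ l0) := ul; apply: filterS => n nl.
rewrite ifF//; apply/negbTE; apply: contraTneq nl => ->.
by rewrite subr0 gtr0_norm// ltxx.
Qed.

(** * Measurability of random linear combinations *)

Section random_coefficients.
Context (R : realType) (dO : measure_display) (Omega : measurableType dO).
Context (N : nat) (eps : 'I_N -> Omega -> R[i]).
Hypothesis eps_meas : forall i, measurable_fun setT (@complex_coords R \o eps i).
Local Notation E := ('rV[R]_N * 'rV[R]_N)%type.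

Let coords (w : Omega) : E :=
  (\row_i complex.Re (eps i w), \row_i complex.Im (eps i w)).

Let measurable_coords : measurable_fun setT coords.
Proof.
apply: measurable_fun_pair; apply: measurable_fun_rV => i.
  rewrite (_ : (fun w => _) = fst \o (@complex_coords R \o eps i)).
    exact: measurableT_comp measurable_fst (eps_meas i).
  by apply/funext => w /=; rewrite mxE.
rewrite (_ : (fun w => _) = snd \o (@complex_coords R \o eps i)).
  exact: measurableT_comp measurable_snd (eps_meas i).
by apply/funext => w /=; rewrite mxE.
Qed.

Let coef (i : 'I_N) (z : E) : R[i] := (z.1 ord0 i +i* z.2 ord0 i)%C.

Let coef_coords i w : coef i (coords w) = eps i w.
Proof. by rewrite /coef !mxE; case: (eps i w). Qed.

Let continuous_coef i : continuous (coef i : E -> R[i]^o).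
Proof.
move=> z; apply: cvg_complex; first exact: (@continuous_phase_coord _ _ (inl i)).
exact: (@continuous_phase_coord _ _ (inr i)).
Qed.

(** Measurability of [eps] is known through its real and imaginary parts. The norm is a continuous
    function of these 2N reals, and such functions are measurable by the grid argument in dimension
    [N]. *)
Lemma measurable_rnorm_random_sum (X : normedModType R[i]) (y : 'I_N -> X) :
  measurable_fun setT (fun w => rnorm (\sum_(i < N) eps i w *: y i)).
Proof.
have cf : continuous (fun z => rnorm (\sum_(i < N) coef i z *: y i)).
  move=> z; apply: cvg_rnorm; apply: cvg_big => [|i _]; first exact: add_continuous.
  by apply: cvgZ; [exact: continuous_coef|exact: cvg_cst].
rewrite (_ : (fun w => _) = (fun z => rnorm (\sum_(i < N) coef i z *: y i)) \o coords).
  exact: measurableT_comp (measurable_continuous_phase cf) measurable_coords.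
by apply/funext => w /=; congr rnorm; apply: eq_bigr => i _; rewrite coef_coords.
Qed.

Lemma measurable_normc_random_sum (y : 'I_N -> R) :
  measurable_fun setT (fun w => \sum_(i < N) normc (eps i w) * y i).
Proof.
have cf : continuous (fun z => \sum_(i < N) rnorm (coef i z : R[i]^o) * y i).
  move=> z; apply: cvg_big => [|i _]; first exact: add_continuous.
  by apply: cvgMl; apply: cvg_rnorm; exact: continuous_coef.
rewrite (_ : (fun w => _) = (fun z => \sum_(i < N) rnorm (coef i z : R[i]^o) * y i) \o coords).
  exact: measurableT_comp (measurable_continuous_phase cf) measurable_coords.
by apply/funext => w /=; apply: eq_bigr => i _; rewrite coef_coords rnorm_complex.
Qed.

End random_coefficients.

(** * Transference of moments of random sums *)

Section transference_integral.
Context (R : realType) (X : completeNormedModType R[i]) (d : nat).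
Context (A B : 'I_d -> unbounded_op X).
Hypothesis AB : weyl_pair A B.
Context (p : R).
Hypothesis p_ge1 : 1 <= p.
Local Notation E := ('rV[R]_d * 'rV[R]_d)%type.
Local Notation mu := (@lebesgue_phase R d).
Local Notation M := (weyl_bound A B).
Local Notation orbit := (cutoff_orbit A B).
Local Notation box_Lp_norm := (@box_Lp_norm R d p).
Hypothesis M_gt0 : 0 < M.

Let p_gt0 : 0 < p. Proof. exact: lt_le_trans p_ge1. Qed.

Lemma box_Lp_norm_gt0 r : 0 < r -> 0 < box_Lp_norm r.
Proof. by move=> r0; rewrite powR_gt0// exprn_gt0// pmulrn_lgt0. Qed.

(* The ratio of the L^p norms of the indicators of the boxes of radii
   [k.+2 * s] and [k.+1 * s]. *)
Definition box_ratio (k : nat) : R := ((k.+2%:R / k.+1%:R) ^+ (d + d)) `^ p^-1.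

Lemma box_Lp_normM k (s : R) : 0 <= s ->
  box_Lp_norm (k.+1%:R * s + s) = box_ratio k * box_Lp_norm (k.+1%:R * s).
Proof.
move=> s0; rewrite -powRM; last 2 first.
- by rewrite exprn_ge0// divr_ge0.
- by rewrite exprn_ge0// mulrn_wge0// mulr_ge0.
rewrite -exprMn; congr ((_ ^+ _) `^ _).
have : k.+1%:R != 0 :> R by rewrite pnatr_eq0.
have -> : k.+2%:R = k.+1%:R + 1 :> R by rewrite natr1.
by rewrite !mulr2n; move: (k.+1%:R) => y y0; field.
Qed.

Lemma box_ratio_cvg1 : box_ratio @ \oo --> (1 : R).
Proof.
rewrite [X in _ --> X](_ : 1 = 1 `^ p^-1); last by rewrite powR1.
apply: cvg_powR; first by rewrite invr_gt0.
  by move=> k; rewrite exprn_ge0// divr_ge0.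
rewrite [X in _ --> X](_ : 1 = 1 ^+ (d + d)); last by rewrite expr1n.
have H : k.+2%:R / k.+1%:R @[k --> \oo] --> (1 : R).
  rewrite (_ : (fun k => _) = fun k => 1 + k.+1%:R^-1); last first.
    by apply/funext => k; rewrite -natr1 mulrDl divff ?pnatr_eq0// mul1r.
  rewrite -[X in _ --> X]addr0; apply: cvgD; first exact: cvg_cst.
  exact: cvg_harmonic.
exact: (cvg_comp _ _ H (@exprn_continuous R (d + d) _)).
Qed.

(** This is the limit of large boxes, in which the cost of the truncation disappears. *)
Lemma le_mul_box_ratio (q x c : R) : 0 < q ->
  (forall k, x <= c * box_ratio k `^ q) -> x <= c.
Proof.
move=> q_gt0 H; rewrite -[c]mulr1.
have cr : c * box_ratio k `^ q @[k --> \oo] --> c * 1.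
  apply: cvgMr; rewrite [X in _ --> X](_ : 1 = 1 `^ q); last by rewrite powR1.
  by apply: cvg_powR => // [k|]; [exact: powR_ge0|exact: box_ratio_cvg1].
by rewrite -(cvg_lim _ cr)//; apply: limr_ge; [exact: cvgP cr|exact: nearW].
Qed.

Context (dO : measure_display) (Omega : measurableType dO) (P : probability Omega R).
Context (q C : R).
Hypothesis q_gt0 : 0 < q.
Hypothesis C_ge0 : 0 <= C.
Context (N : nat) (eps : 'I_N -> Omega -> R[i]).
Hypothesis eps_meas : forall i, measurable_fun setT (@complex_coords R \o eps i).
Context (a : 'I_N -> E -> R[i]) (x : 'I_N -> X).
Hypothesis a_schwartz : forall i, schwartz (a i).

(** The abstract [J] is the q-th moment of the sum of the vectors in part (2), possibly infinite,
    and the norm of the fixed vector in part (3). One factor [M] in the constant comes with the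
    orbits in the assumption, the other from inverting W(-z). *)
Lemma transference_integral :
  forall J : \bar R, (0 <= J)%E ->
  (forall r : R, 0 <= r ->
    (\int[P]_w (Lp_norm mu p (\sum_(i < N) eps i w *:
       (twisted_convolution (fourier (a i)) (orbit r (x i)) : E -> X))%R `^ q) <=
     ((C * (M * box_Lp_norm r)) `^ q)%:E * J)%E) ->
  (\int[P]_w ((rnorm (\sum_(i < N) eps i w *: weyl_calculus A B (a i) (x i))) `^ q)%:E <=
   ((M ^+ 2 * C) `^ q)%:E * J)%E.
Proof.
move=> J J_ge0 HC; have [e [e_ge0 e0 Lpge]] := Lp_norm_twisted_sum_ge AB p_ge1 a_schwartz M_gt0.
pose al w := rnorm (\sum_(i < N) eps i w *: weyl_calculus A B (a i) (x i)).
pose de m w := \sum_(i < N) normc (eps i w) * (e i m.+1 * rnorm (x i)).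
(* This is the pointwise lower bound supplied by [Lpge]. The shift to [m.+1] in [de] keeps the radii
   of the boxes positive. *)
pose psi m w := Num.max 0 (al w / M - de m w).
have al_ge0 w : 0 <= al w by exact: rnorm_ge0.
have psi_ge0 m w : 0 <= psi m w by rewrite le_max lexx.
have M_ge0 := ltW M_gt0.
have mal : measurable_fun setT al by exact: measurable_rnorm_random_sum.
have mpsi m : measurable_fun setT (psi m).
  apply: measurable_maxr => //; apply: measurable_funB; first exact: measurable_funM.
  exact: measurable_normc_random_sum.
have mpow (f : Omega -> R) : measurable_fun setT f ->
    measurable_fun setT (fun w => (f w `^ q)%:E).
  move=> mf; apply/measurable_EFinP.
  exact: (measurableT_comp (measurable_powR q) mf).
have pow_ge0 (f : Omega -> R) w : (0 <= (f w `^ q)%:E)%E by rewrite lee_fin powR_ge0.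
pose I m := (\int[P]_w (psi m w `^ q)%:E)%E.
(* With n = (k+1)(m+1) and r = (k+2)(m+1) the ratio of the norms of the two indicators is
   [box_ratio k], whatever [m] is. *)
have step m k : (I m <= ((C * M * box_ratio k) `^ q)%:E * J)%E.
  pose n : R := k.+1%:R * m.+1%:R; pose r : R := n + m.+1%:R.
  have n_gt0 : 0 < n by rewrite mulr_gt0.
  have r_ge0 : 0 <= r by rewrite addr_ge0// ltW.
  have ln_gt0 := box_Lp_norm_gt0 n_gt0.
  have CMt : 0 <= C * M * box_ratio k.
    by apply: mulr_ge0 (powR_ge0 _ _); exact: mulr_ge0.
  have lr_ge0 : 0 <= box_Lp_norm r by exact: powR_ge0.
  have lowb : ((box_Lp_norm n `^ q)%:E * I m <= \int[P]_w (Lp_norm mu p (\sum_(i < N) eps i w *: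
       (twisted_convolution (fourier (a i)) (orbit r (x i)) : E -> X))%R `^ q))%E.
    rewrite -ge0_integralZl_EFin ?powR_ge0//; last exact: mpow.
    apply: ge0_integral_mono => w; first by rewrite -EFinM lee_fin mulr_ge0 ?powR_ge0.
    rewrite -EFinM -powRM ?(ltW ln_gt0)// -poweR_EFin.
    apply: gt0_ler_poweR; first exact: ltW.
    - by rewrite in_itv/= leey andbT lee_fin mulr_ge0// ltW.
    - by rewrite in_itv/= leey andbT; exact: Lnorm_ge0.
    by rewrite mulrC; exact: (Lpge (eps ^~ w) x n m.+1 (ltW n_gt0)).
  have := le_trans lowb (HC r r_ge0).
  have -> : C * (M * box_Lp_norm r) = box_Lp_norm n * (C * M * box_ratio k).
    by rewrite /r /n box_Lp_normM//; ring.
  rewrite powRM ?CMt ?(ltW ln_gt0)// EFinM -muleA.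
  by rewrite lee_pmul2l// lte_fin powR_gt0.
have bound m : (I m <= ((C * M) `^ q)%:E * J)%E.
  have CM0 : 0 <= C * M by exact: mulr_ge0.
  have I_ge0 : (0 <= I m)%E by exact: integral_ge0.
  (* The limit in [k] is taken in the reals, for finite [J]. For infinite [J] the right-hand side is
     infinite unless C M = 0, and then the bound at k = 0 already has the desired right-hand
     side. *)
  case: (J) J_ge0 (step m) => [j| |//] j0 Hj.
    have Ifin : I m \is a fin_num.
      by rewrite ge0_fin_numE//; apply: le_lt_trans (Hj 0%N) _; rewrite -EFinM ltry.
    rewrite -(fineK Ifin) -EFinM lee_fin; apply: (le_mul_box_ratio q_gt0) => k.
    by rewrite -lee_fin fineK// mulrAC EFinM -powRM ?powR_ge0//; exact: Hj.
  have [CM|CM] := eqVneq (C * M) 0.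
    by have := Hj 0%N; rewrite CM mul0r.
  by rewrite gt0_muley ?leey// lte_fin powR_gt0// lt0r CM.
have lim_psi w : (psi m w `^ q)%:E @[m --> \oo] --> ((al w / M) `^ q)%:E.
  apply/fine_cvgP; split; first exact: nearW.
  apply: cvg_powR => //.
  have de0 : de m w @[m --> \oo] --> (0 : R).
    rewrite [X in _ --> X](_ : 0 = \sum_(i < N) normc (eps i w) * (0 * rnorm (x i))).
      apply: cvg_big => [|i _]; first exact: add_continuous.
      apply: cvgMr; apply: cvgMl; have := e0 i.
      by rewrite -cvg_shiftS.
    by rewrite big1// => i _; rewrite mul0r mulr0.
  have ald : al w / M - de m w @[m --> \oo] --> al w / M.
    by rewrite -[X in _ --> X]subr0; apply: cvgB => //; exact: cvg_cst.
  have al0 : 0 <= al w / M by rewrite divr_ge0.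
  apply: (@squeeze_cvgr _ _ _ _ (fun m => al w / M - de m w) (cst (al w / M))) => //.
    apply: nearW => m; rewrite /psi le_max lexx orbT/= ge_max al0/=.
    by rewrite gerBl sumr_ge0// => i _; rewrite mulr_ge0 ?normc_ge0// mulr_ge0 ?rnorm_ge0.
  exact: cvg_cst.
have fat := @fatou _ _ _ P setT measurableT (fun m w => (psi m w `^ q)%:E)
  (fun m => mpow _ (mpsi m)) (fun m w _ => pow_ge0 (psi m) w).
have lim_le : (limn_einf (fun m => I m) <= ((C * M) `^ q)%:E * J)%E.
  rewrite limn_einf_lim; apply: lime_le; first exact: is_cvg_einfs.
  by apply: nearW => m; apply: le_trans (bound m); apply: ereal_inf_lbound; exists m => /=.
have Elim : (\int[P]_w limn_einf (fun m => (psi m w `^ q)%:E) =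
    \int[P]_w ((al w / M) `^ q)%:E)%E.
  by apply: eq_integral => w _; have [-> _] := cvg_limn_einf_sup (lim_psi w).
have {fat} := le_trans fat lim_le; rewrite Elim => fin.
(* Undoing the division by [M] yields the second factor of M^2. *)
have -> : (\int[P]_w (al w `^ q)%:E = (M `^ q)%:E * \int[P]_w ((al w / M) `^ q)%:E)%E.
  rewrite -ge0_integralZl_EFin ?powR_ge0//.
  - apply: eq_integral => w _; rewrite -EFinM -powRM ?divr_ge0//.
    by rewrite mulrC divfK ?lt0r_neq0.
  - by move=> w _; exact: (pow_ge0 (fun w => al w / M)).
  - by apply: (mpow (fun w => al w / M)); exact: measurable_funM.
have -> : (M ^+ 2 * C) `^ q = M `^ q * (C * M) `^ q.
  by rewrite -powRM ?(mulr_ge0 C_ge0 M_ge0)//; congr (_ `^ _); ring.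
by rewrite EFinM -muleA lee_wpmul2l// lee_fin powR_ge0.
Qed.

Lemma integral_Lp_norm_orbit_le (r : R) : 0 <= r ->
  (\int[P]_w (Lp_norm mu p (\sum_(i < N) eps i w *: (orbit r (x i) : E -> X))%R `^ q) <=
   ((M * box_Lp_norm r) `^ q)%:E *
   \int[P]_w ((rnorm (\sum_(i < N) eps i w *: x i)) `^ q)%:E)%E.
Proof.
move=> r0; have Ml0 : 0 <= M * box_Lp_norm r.
  by apply: mulr_ge0; [exact: ltW|exact: powR_ge0].
rewrite -ge0_integralZl_EFin ?powR_ge0//; last 2 first.
- by move=> w _; rewrite lee_fin powR_ge0.
- apply/measurable_EFinP; apply: (measurableT_comp (measurable_powR q)).
  exact: measurable_rnorm_random_sum.
apply: ge0_integral_mono => w; first exact: poweR_ge0.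
rewrite -EFinM -powRM ?rnorm_ge0// -poweR_EFin mulrAC.
apply: gt0_ler_poweR; first exact: ltW.
- by rewrite in_itv/= leey andbT; exact: Lnorm_ge0.
- rewrite in_itv/= leey andbT lee_fin mulrAC.
  by apply: mulr_ge0 (rnorm_ge0 _).
exact: Lp_norm_orbit_sum_le.
Qed.

End transference_integral.

Lemma expe2M (R : realType) (x y : \bar R) : x \is a fin_num -> y \is a fin_num ->
  (x ^+ 2 * y ^+ 2)%E = ((fine x * fine y) ^+ 2)%:E.
Proof. by move=> /fineK<- /fineK<-; rewrite -!EFin_expe -EFinM exprMn. Qed.

(** * Transference of the operator norm *)

Section transference_norm.
Context (R : realType) (X : completeNormedModType R[i]) (d : nat).
Context (A B : 'I_d -> unbounded_op X).
Hypothesis AB : weyl_pair A B.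
Local Notation E := ('rV[R]_d * 'rV[R]_d)%type.
Local Notation mu := (@lebesgue_phase R d).
Local Notation M := (weyl_bound A B).
Local Notation orbit := (cutoff_orbit A B).

(** Homogeneity allows a vector to be shrunk until its truncated orbit lies in the unit ball of
    L^p. *)
Lemma weyl_calculusZ (a : E -> R[i]) (c : R[i]) (x : X) : schwartz a ->
  weyl_calculus A B a (c *: x) = c *: weyl_calculus A B a x.
Proof.
move=> sa; pose f w := fourier a w *: exp_weyl A B w x.
have [K HK] := normc_fourier_le sa.
have fP : simple_limit mu f.
  by apply/simple_limit_continuous/continuous_fourier_scale => //; exact: continuous_exp_weyl.
have fK w : rnorm (f w) <= K * M * rnorm x * phase_weight w.
  rewrite rnormZ (_ : K * M * _ * _ = (K * phase_weight w) * (M * rnorm x)); last by ring.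
  by apply: ler_pM; [exact: normc_ge0|exact: rnorm_ge0|exact: HK|exact: rnorm_exp_weyl].
have If := bochner_integrableP fP (L1_norm_weight_lty fK).
have linc : linear (fun y : X => c *: y).
  by move=> b y z; rewrite scalerDr !scalerA mulrC.
have boundc (y : X) : rnorm (c *: y) <= normc c * rnorm y by rewrite rnormZ.
have Icf := is_bochner_integral_map linc boundc fP If.
rewrite /weyl_calculus scalerA [c * _]mulrC -scalerA; congr (_ *: _).
have gE : (fun w => fourier a w *: exp_weyl A B w (c *: x)) = (fun y => c *: y) \o f.
  apply/funext => w; rewrite /f /= (linear_scale _ _ (exp_weyl_linear AB _)).
  by move: (exp_weyl A B w x) (fourier a w) => y b; rewrite !scalerA mulrC.
rewrite gE; apply: bochner_integralE => //.
rewrite -gE; apply/simple_limit_continuous/continuous_fourier_scale => //.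
exact: continuous_exp_weyl.
Qed.

Context (p : R).
Hypothesis p_ge1 : 1 <= p.
Hypothesis M_gt0 : 0 < M.

Lemma rnorm_weyl_calculus_le (a : E -> R[i]) (k : R) (x : X) : schwartz a ->
  (forall g : E -> X, Lp_fun mu p g -> (Lp_norm mu p g <= 1)%E ->
    (Lp_norm mu p (twisted_convolution (fourier a) g) <= k%:E)%E) ->
  rnorm x <= 1 -> rnorm (weyl_calculus A B a x) <= M ^+ 2 * k.
Proof.
move=> sa Ck x1.
have [e [e_ge0 e0 Lpge]] := Lp_norm_twisted_sum_ge AB p_ge1 (fun _ : 'I_1 => sa) M_gt0.
set al := rnorm (weyl_calculus A B a x).
have step m j : al / M - e ord0 m.+1 * rnorm x <= k * M * box_ratio d p j `^ 1.
  pose n : R := j.+1%:R * m.+1%:R; pose r : R := n + m.+1%:R.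
  have n_gt0 : 0 < n by rewrite mulr_gt0.
  have r_gt0 : 0 < r by rewrite addr_gt0.
  have ln_gt0 := box_Lp_norm_gt0 d p n_gt0.
  have lr_gt0 := box_Lp_norm_gt0 d p r_gt0.
  (* This bounds the L^p norm of the truncated orbit of a unit vector. Dividing [x] by it brings the
     orbit into the unit ball, where [Ck] applies. *)
  pose rho := M * box_Lp_norm d p r.
  have rho_gt0 : 0 < rho by exact: mulr_gt0.
  pose y := (rho^-1)%:C%C *: x.
  have ny : rnorm y = rho^-1 * rnorm x by rewrite rnormZ normc_real gtr0_norm// invr_gt0.
  have orbit1 : (Lp_norm mu p (orbit r y) <= 1)%E.
    have := Lp_norm_orbit_sum_le AB p_ge1 (fun _ : 'I_1 => 1) (fun=> y) (ltW r_gt0).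
    rewrite !big_ord1 !scale1r => /le_trans; apply.
    by rewrite ny mulrAC -/rho mulrA divff ?lt0r_neq0// mul1r lee_fin.
  have := Ck _ (cutoff_orbit_Lp_fun AB p_ge1 y (ltW r_gt0)) orbit1.
  have := Lpge (fun _ : 'I_1 => 1) (fun=> y) n m.+1 (ltW n_gt0).
  rewrite !big_ord1 !scale1r => /le_trans /[apply].
  rewrite lee_fin (ComplexField.Normc.normc1 R) mul1r ny weyl_calculusZ// rnormZ normc_real.
  rewrite gtr0_norm ?invr_gt0// -/al => H.
  have {}H : rho^-1 * (al / M - e ord0 m.+1 * rnorm x) * box_Lp_norm d p n <= k.
    apply: le_trans H; rewrite ler_wpM2r ?(ltW ln_gt0)// le_max; apply/orP; right.
    by rewrite le_eqVlt; apply/orP; left; apply/eqP; ring.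
  rewrite powRr1 ?powR_ge0//.
  have rhoE : rho = M * (box_ratio d p j * box_Lp_norm d p n).
    by rewrite /rho /r /n box_Lp_normM.
  rewrite -mulrA ler_pdivrMl// in H.
  rewrite -(ler_pM2r ln_gt0).
  by apply: le_trans H _; rewrite rhoE le_eqVlt; apply/orP; left; apply/eqP; ring.
have {}step m : al / M - e ord0 m.+1 * rnorm x <= k * M.
  by apply: (le_mul_box_ratio (d := d) (p := p) p_ge1 (q := 1)) => // j; exact: step.
have lim_e : al / M - e ord0 m.+1 * rnorm x @[m --> \oo] --> al / M.
  rewrite [X in _ --> X](_ : _ = al / M - 0 * rnorm x); last by rewrite mul0r subr0.
  apply: cvgB; first exact: cvg_cst.
  by apply: cvgMl; have := e0 ord0; rewrite -cvg_shiftS.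
have : al / M <= k * M.
  by rewrite -(cvg_lim _ lim_e)//; apply: limr_le; [exact: cvgP lim_e|exact: nearW].
by rewrite ler_pdivrMr// (_ : k * M * M = M ^+ 2 * k)//; ring.
Qed.

End transference_norm.

Theorem proposition6p1 (R : realType) (X : completeNormedModType R[i]) (d : nat)
    (A B : 'I_d -> unbounded_op X) (AB_weyl : weyl_pair A B)
    (p : R) (p_ge1 : 1 <= p) :
  let XS := normed_space X in
  let LpX := Lp_space (@lebesgue_phase R d) X p in
  let aAB (a : 'rV[R]_d * 'rV[R]_d -> R[i]) : XS -> XS := weyl_calculus A B a in
  let C_hat (a : 'rV[R]_d * 'rV[R]_d -> R[i]) : LpX -> LpX :=
    twisted_convolution (fourier a) in
  let M_A := group_bound A in
  let M_B := group_bound B in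
  [/\
    forall a : 'rV[R]_d * 'rV[R]_d -> R[i], schwartz a ->
      (opnorm (aAB a) <= M_A ^+ 2 * M_B ^+ 2 * opnorm (C_hat a))%E,
    forall (J : Type) (a : J -> 'rV[R]_d * 'rV[R]_d -> R[i])
        (dO : measure_display) (Omega : measurableType dO)
        (P : probability Omega R) (eps : nat -> Omega -> R[i]),
      (forall j, schwartz (a j)) -> rademacher P eps ->
      R_bounded P eps [set C_hat (a j) | j in [set: J]] ->
      R_bounded P eps [set aAB (a j) | j in [set: J]] /\
      (R_bound P eps p [set aAB (a j) | j in [set: J]] <=
       M_A ^+ 2 * M_B ^+ 2 * R_bound P eps p [set C_hat (a j) | j in [set: J]])%E
  & forall (J : choiceType) (a : J -> 'rV[R]_d * 'rV[R]_d -> R[i])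
        (dO : measure_display) (Omega : measurableType dO)
        (P : probability Omega R) (eps : J -> Omega -> R[i]),
      (forall j, schwartz (a j)) -> rademacher P eps ->
      (exists C : R, forall F g, summation_sets F -> sn_dom g ->
        (\int[P]_w sn_norm (\sum_(j \in F) eps j w *: C_hat (a j) g) <=
         C%:E * sn_norm g)%E) ->
      exists C' : R, forall F f, summation_sets F -> sn_dom f ->
        (\int[P]_w sn_norm (\sum_(j \in F) eps j w *: aAB (a j) f) <=
         C'%:E * sn_norm f)%E].
Proof.
move=> XS LpX aAB C_hat M_A M_B; have [A_gen B_gen _ _ _] := AB_weyl.
have MA_ge0 : (0 <= M_A)%E by exact: group_bound_ge0.
have MB_ge0 : (0 <= M_B)%E by exact: group_bound_ge0.
have MAB_ge0 : (0 <= M_A ^+ 2 * M_B ^+ 2)%E 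
  by apply: mule_ge0; apply: expe_ge0.
(* A supremum over an empty set would be -oo. The test function is the zero function, in the form of
   an orbit of 0, whose membership in L^p is already known. *)
have C_ge0 a : (0 <= opnorm (C_hat a))%E.
  apply: (@le_trans _ _ (sn_norm (C_hat a (cutoff_orbit A B 0 0)))).
    exact: Lnorm_ge0.
  apply: ereal_sup_ubound; exists (cutoff_orbit A B 0 0) => //; split.
    exact: cutoff_orbit_Lp_fun.
  apply: le_trans (Lp_norm_le p_ge1 (lexx 0) (lexx 0) _ _) _ => [z z0|z z0|].
  - rewrite /cutoff_orbit mem_set// (le_trans (rnorm_exp_weyl AB_weyl _ _))//.
    by rewrite rnorm0 mulr0.
  - by rewrite /cutoff_orbit memNset.
  - by rewrite mul0r.
(* On the zero space every norm is 0 and the three claims are immediate; on any other space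
   [weyl_bound] is positive. *)
have [X0|/existsNP[x0 /eqP x0_neq0]] := pselect (forall x : X, x = 0).
  have rX0 (x : X) : rnorm x = 0 by rewrite (X0 x) rnorm0.
  have Rb0 (J : Type) (a : J -> 'rV[R]_d * 'rV[R]_d -> R[i]) (dO : measure_display)
      (Omega : measurableType dO) (P : probability Omega R) (eps : nat -> Omega -> R[i])
      (q : R) : 0 < q -> R_bound_by P eps q 0 [set aAB (a j) | j in [set: J]].
    move=> q0 N S y _ _; rewrite powR0 ?lt0r_neq0// mul0e.
    under eq_integral do rewrite /= rX0 powR0 ?lt0r_neq0//.
    by rewrite integral0.
  split=> [a sa|J a dO Omega P eps sa rad [q q0 _]|J a dO Omega P eps sa rad _].
  - apply: (@le_trans _ _ 0%E).
      by apply: ge_ereal_sup => _ [x _ <-] /=; rewrite rX0.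
    by rewrite mule_ge0.
  - split; first by exists q => //; exists 0 => //; exact: Rb0.
    apply: (@le_trans _ _ 0%E).
      by apply: ereal_inf_lbound; exists 0 => //; split=> //; apply: Rb0; exact: lt_le_trans p_ge1.
    rewrite mule_ge0//; apply: le_ereal_inf_tmp => _ [C [C0 _] <-].
    by rewrite lee_fin.
  - exists 0 => F f _ _; under eq_integral do rewrite /= rX0.
    by rewrite integral0 mul0e.
set M := weyl_bound A B.
have M_gt0 : 0 < M.
  by rewrite mulr_gt0// (lt_le_trans ltr01)// (group_bound_ge1 _ x0_neq0).
have MABE : (M_A ^+ 2 * M_B ^+ 2 = (M ^+ 2)%:E)%E.
  exact: expe2M (group_bound_fin_num A_gen) (group_bound_fin_num B_gen).
have M2_gt0 : 0 < M ^+ 2 by rewrite exprn_gt0.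
rewrite MABE; split.
- move=> a sa.
  case CE : (opnorm (C_hat a)) (C_ge0 a) => [k| |//] k0; last by rewrite gt0_muley ?lte_fin// leey.
  apply: ge_ereal_sup => _ [x [_ x1] <-] /=; rewrite -EFinM lee_fin.
  apply: (rnorm_weyl_calculus_le AB_weyl p_ge1 M_gt0 sa) => [g gL g1|].
    by rewrite -CE; apply: ereal_sup_ubound; exists g.
  by rewrite -lee_fin.
- move=> J a dO Omega P eps sa [eps_meas _ _] Rb.
  (* The moment [q] is preserved. This gives R-boundedness from whichever exponent the assumption
     provides, and the inequality of R-bounds by taking q = p. *)
  have key q C : 0 < q -> 0 <= C ->
      R_bound_by P eps q C [set C_hat (a j) | j in [set: J]] ->
      R_bound_by P eps q (M ^+ 2 * C) [set aAB (a j) | j in [set: J]].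
    move=> q0 C0 RC N S y HS _.
    have /choice[j jS] : forall n, exists j, aAB (a j) = S n.
      by move=> n; have [j _ <-] := HS n; exists j.
    under eq_integral => w _ do under eq_bigr => n _ do rewrite -jS.
    suff H : (\int[P]_w (rnorm (\sum_(n < N) eps n w *:
          weyl_calculus A B (a (j n)) (y n)) `^ q)%:E <= ((M ^+ 2 * C) `^ q)%:E *
        \int[P]_w (rnorm (\sum_(n < N) eps n w *: (y n : X)) `^ q)%:E)%E by exact: H.
    have TI := @transference_integral _ _ _ _ _ AB_weyl _ p_ge1 M_gt0 _ _ P _ _ q0 C0 _
      (fun i : 'I_N => eps i) (fun i => eps_meas i) _ y (fun i => sa (j i)).
    apply: TI.
      by apply: integral_ge0 => w _; rewrite lee_fin powR_ge0.
    move=> r r0; apply: le_trans (RC N (fun n => C_hat (a (j n)))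
      (fun n => cutoff_orbit A B r (y n)) _ _) _.
    + by move=> n; exists (j n).
    + by move=> n; exact: cutoff_orbit_Lp_fun.
    + have Ml0 : 0 <= M * box_Lp_norm d p r := mulr_ge0 (ltW M_gt0) (powR_ge0 _ _).
      rewrite (powRM _ C0 Ml0) EFinM -muleA.
      rewrite lee_wpmul2l ?lee_fin ?powR_ge0//.
      exact: (integral_Lp_norm_orbit_le AB_weyl p_ge1 M_gt0 P q0 (fun i : 'I_N => eps_meas i)).
  split.
    have [q q0 [C C0 RC]] := Rb; exists q => //; exists (M ^+ 2 * C).
      by rewrite mulr_ge0// ltW.
    exact: key.
  (* With M^2 moved to the left, the claim becomes a lower bound for the infimum, checked on each
     admissible [C]. *)
  rewrite -lee_pdivrMl//; apply: le_ereal_inf_tmp => _ [C [C0 RC] <-].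
  rewrite lee_pdivrMl// -EFinM; apply: ereal_inf_lbound; exists (M ^+ 2 * C) => //.
  split; first by rewrite mulr_ge0// ltW.
  by apply: key => //; exact: lt_le_trans p_ge1.
- move=> J a dO Omega P eps sa [eps_meas _ _] [C HC].
  (* The given [C] may be negative, for instance when every L^p norm is 0, while the transference
     asks for a nonnegative constant. *)
  exists (M ^+ 2 * Num.max 0 C) => F f FS _.
  have finF : finite_set F by case: FS.
  have C0 : 0 <= Num.max 0 C by rewrite le_max lexx.
  (* Enumerating [F] turns the sum into one over ordinals, the form used by [transference_integral].
     It is applied with moment 1, the constant family [f], and the norm of [f] for [J]. *)
  pose s := finmap.enum_fset (fset_set F).
  have sumE (V : nmodType) (h : J -> V) :
      \sum_(j \in F) h j = \sum_(i < size s) h (tnth (in_tuple s) i).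
    by rewrite fsbig_finite//= big_tnth.
  pose t (i : 'I_(size s)) := tnth (in_tuple s) i.
  have t_meas (i : 'I_(size s)) : measurable_fun setT (@complex_coords R \o eps (t i)).
    exact: eps_meas.
  have TI := @transference_integral _ _ _ _ _ AB_weyl _ p_ge1 M_gt0 _ _ P _ _ ltr01 C0 _
    (fun i => eps (t i)) t_meas _ (fun=> f) (fun i => sa (t i)) (rnorm f)%:E.
  have {TI} := TI _ _; rewrite lee_fin rnorm_ge0 => /(_ isT) TI.
  have rhsE : ((M ^+ 2 * Num.max 0 C) `^ 1 = M ^+ 2 * Num.max 0 C).
    by rewrite powRr1// mulr_ge0// ltW.
  rewrite rhsE in TI; apply: le_trans (TI _) => [|r r0].
    under eq_integral do rewrite sumE; under [leRHS]eq_integral do rewrite powRr1 ?rnorm_ge0//.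
    exact: lexx.
  have Ml0 : 0 <= M * box_Lp_norm d p r := mulr_ge0 (ltW M_gt0) (powR_ge0 _ _).
  rewrite (powRr1 (mulr_ge0 C0 Ml0)) -EFinM.
  have := HC F _ FS (cutoff_orbit_Lp_fun AB_weyl p_ge1 f r0).
  under eq_integral do rewrite sumE.
  under [X in _ -> (X <= _)%E]eq_integral do rewrite poweRe1 ?Lnorm_ge0//.
  move=> /le_trans; apply.
  have orb := Lp_norm_orbit_sum_le AB_weyl p_ge1 (fun _ : 'I_1 => 1) (fun=> f) r0.
  rewrite !big_ord1 !scale1r in orb.
  apply: (@le_trans _ _ ((Num.max 0 C)%:E * Lp_norm (@lebesgue_phase R d) p (cutoff_orbit A B r f))%E).
    by apply: lee_wpmul2r; [exact: Lnorm_ge0|rewrite lee_fin le_max lexx orbT].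
  apply: le_trans (lee_wpmul2l _ orb) _; first by rewrite lee_fin.
  by rewrite -EFinM lee_fin -!mulrA [rnorm f * _]mulrC.
Qed.
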